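(* Let $\mathfrak S$ be a symmetrically-normed ideal of operators on $\mathcal H$. Let $\{B_n\}_{n\ge 1}$ be a sequence in $\mathcal{CR}$ and let $B\in\mathcal{CR}$ be such that $B_n-B\in\mathfrak S$ for all $n$ and $\|B_n-B\|_{\mathfrak S}\to 0$. Then the following conditions are equivalent: (i) $[P_{N(B_n)}:P_{N(B)}]=0$ for all sufficiently large $n$; (ii) $\sup_n\|B_n^\dagger\|<\infty$; (iii) $\|B_n^\dagger-B^\dagger\|_{\mathfrak S}\to 0$; (iv) $\|P_{N(B_n)}-P_{N(B)}\|_{\mathfrak S}<1$ for all sufficiently large $n$; (v) $\|P_{N(B_n)}-P_{N(B)}\|<1$ for all sufficiently large $n$; (vi) $N(B_n)^\perp\cap N(B)=\{0\}$ for all sufficiently large $n$.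
   Context: $\mathcal H$ is a separable complex infinite-dimensional Hilbert space, $\mathcal B(\mathcal H)$ its algebra of bounded operators with operator norm $\|\cdot\|$; $N(A)$, $R(A)$ denote nullspace and range; $P_{\mathcal S}$ is the orthogonal projection onto a closed subspace $\mathcal S$. $\mathcal{CR}\subset\mathcal B(\mathcal H)$ is the set of closed range operators. For $A\in\mathcal{CR}$, $A^\dagger$ is the Moore-Penrose inverse, i.e. the unique $X\in\mathcal B(\mathcal H)$ with $AXA=A$, $XAX=X$, $(AX)^*=AX$, $(XA)^*=XA$. A symmetrically-normed ideal is a two-sided ideal $\mathfrak S\subseteq\mathcal B(\mathcal H)$ with a norm $\|\cdot\|_{\mathfrak S}$ making it a Banach space, such that $\|ABC\|_{\mathfrak S}\le\|A\|\,\|B\|_{\mathfrak S}\|C\|$ for $A,C\in\mathcal B(\mathcal H)$, $B\in\mathfrak S$, and $\|B\|_{\mathfrak S}=\|B\|$ for every rank-one $B$. One has (finite-rank operators) $\subseteq\mathfrak S\subseteq$ (compact operators). If $P,Q$ are orthogonal projections such that $QP|_{R(P)}:R(P)\to R(Q)$ is Fredholm (in particular if $P-Q$ is compact), the essential codimension is the Fredholm index $[P:Q]=\mathrm{Ind}(QP|_{R(P)}:R(P)\to R(Q))=\dim(N(Q)\cap R(P))-\dim(R(Q)\cap N(P))$. If $A,B\in\mathcal{CR}$ and $A-B\in\mathfrak S$, then $A^\dagger-B^\dagger$, $P_{N(A)}-P_{N(B)}$ and $P_{R(A)}-P_{R(B)}$ belong to $\mathfrak S$, so the quantities in the claim are well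 defined. *)

(* Defs.v *)
From HB Require Import structures.
From mathcomp Require Import all_boot all_order all_algebra.
From mathcomp Require Import complex.
From mathcomp Require Import all_classical all_reals all_analysis.

Set Implicit Arguments.
Unset Strict Implicit.
Unset Printing Implicit Defensive.

Import Order.TTheory GRing.Theory Num.Theory.
Import numFieldNormedType.Exports.

Local Open Scope classical_set_scope.
Local Open Scope ring_scope.

(* Operators are plain functions H -> H, with the pointwise module structure
   of mathcomp.classical; boundedness is carried by predicates. *)

Section NormedSpace.
Context {R : realType} {H : completeNormedModType R[i]}.
Implicit Types (A B C P Q : H -> H) (U V W : set H).

(* The library norm of H takes its values in R[i], on the nonnegative reals;
   rnorm is the same norm as an element of R. *)
Definition rnorm (x : H) : R := complex.Re `|x|.

Definition separable := exists D : set H, countable D /\ dense D.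

(* W is a subspace of V and V / W has finite dimension n: the classes of the
   e i form a basis of V / W. *)
Definition has_dim_mod V W (n : nat) :=
  exists e : 'I_n -> H,
    (forall x, V x <-> exists (w : H) (c : 'I_n -> R[i]),
        W w /\ x = w + \sum_i c i *: e i) /\
    (forall c : 'I_n -> R[i], W (\sum_i c i *: e i) -> forall i, c i = 0).

Definition has_dim V (n : nat) := has_dim_mod V [set 0] n.

Definition infinite_dimensional := forall n, ~ has_dim setT n.

(* Meaningful only when the dimension is finite. *)
Definition dim_mod V W : nat := xget 0%N [set n | has_dim_mod V W n].

Definition bounded_op A :=
  linear A /\ exists M : R, forall x, rnorm (A x) <= M * rnorm x.

Definition opnorm A : R := sup [set rnorm (A x) | x in [set x | rnorm x <= 1]].

Definition closed_range_op A := bounded_op A /\ closed (range A).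

Definition compact_op A :=
  bounded_op A /\ compact (closure (A @` [set x | rnorm x <= 1])).

Definition finite_rank_op A := bounded_op A /\ exists n, has_dim (range A) n.

Definition rank_one_op A := bounded_op A /\ has_dim (range A) 1.

Definition nullspace A : set H := [set x | A x = 0].

Definition kernel_on U A : set H := U `&` nullspace A.

(* A is seen as an operator from U to V. *)
Definition fredholm_between U V A :=
  (forall x, U x -> V (A x)) /\
  (exists m, has_dim (kernel_on U A) m) /\
  (exists n, has_dim_mod V (A @` U) n).

Definition fredholm_index U V A : int :=
  (dim_mod (kernel_on U A) [set 0])%:Z - (dim_mod V (A @` U))%:Z.

(* The pair (P, Q) is that of [P : Q], for orthogonal projections P and Q. *)
Definition fredholm_pair P Q := fredholm_between (range P) (range Q) (Q \o P).

Definition ess_codim P Q : int :=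
  fredholm_index (range P) (range Q) (Q \o P).

End NormedSpace.

Arguments separable {R} H.
Arguments infinite_dimensional {R} H.

Record symnormed_ideal (R : realType) (H : completeNormedModType R[i]) := {
  ideal_set : set (H -> H);
  (* only the values on ideal_set are meaningful *)
  ideal_norm : (H -> H) -> R;
  ideal0 : ideal_set 0;
  ideal_linear : forall (c : R[i]) A B,
    ideal_set A -> ideal_set B -> ideal_set (c *: A + B);
  ideal_mulr : forall A B, ideal_set A -> bounded_op B -> ideal_set (A \o B);
  ideal_mull : forall A B, bounded_op A -> ideal_set B -> ideal_set (A \o B);
  ideal_finite_rank : forall A, finite_rank_op A -> ideal_set A;
  ideal_compact : forall A, ideal_set A -> compact_op A;
  ideal_normD : forall A B, ideal_set A -> ideal_set B ->
    ideal_norm (A + B) <= ideal_norm A + ideal_norm B;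
  ideal_normZ : forall (c : R[i]) A, ideal_set A ->
    ideal_norm (c *: A) = complex.Re `|c| * ideal_norm A;
  ideal_norm0_eq0 : forall A, ideal_set A -> ideal_norm A = 0 -> A = 0;
  ideal_complete : forall A_ : nat -> H -> H,
    (forall n, ideal_set (A_ n)) ->
    (forall e : R, 0 < e -> exists N, forall m n, (N <= m)%N -> (N <= n)%N ->
      ideal_norm (A_ m - A_ n) < e) ->
    exists A, ideal_set A /\
      (fun n => ideal_norm (A_ n - A)) @ \oo --> (0 : R);
  ideal_normM : forall A B C, bounded_op A -> ideal_set B -> bounded_op C ->
    ideal_norm (A \o B \o C) <= opnorm A * ideal_norm B * opnorm C;
  ideal_norm_rank_one : forall A, rank_one_op A -> ideal_norm A = opnorm A
}.

Definition cvg_in_ideal (R : realType) (H : completeNormedModType R[i])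
    (S : symnormed_ideal H) (A_ : nat -> H -> H) (A : H -> H) :=
  (forall n, ideal_set S (A_ n - A)) /\
  (fun n => ideal_norm S (A_ n - A)) @ \oo --> (0 : R).

Section InnerProduct.
Context {R : realType} {H : completeNormedModType R[i]}.
Variable dot : {dot H for (@Num.conj R[i])}.
Implicit Types (A X P : H -> H) (S : set H).

(* With completeness of H, this makes H a Hilbert space; dot is linear in its
   first argument. *)
Definition inner_product_norm := forall x : H, `|x| ^+ 2 = dot x x.

Definition is_adjoint A X := forall x y, dot (A x) y = dot x (X y).

Definition self_adjoint A := is_adjoint A A.

Definition orthogonal_compl S : set H :=
  [set x | forall y, S y -> dot x y = 0].

(* Meaningful only when S is a closed subspace. *)
Definition orth_proj S : H -> H :=
  xget 0 [set P | bounded_op P /\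
    forall x, S (P x) /\ orthogonal_compl S (x - P x)].

Definition is_mp_inverse A X :=
  [/\ bounded_op X, A \o X \o A = A, X \o A \o X = X,
      self_adjoint (A \o X) & self_adjoint (X \o A)].

(* Meaningful only when A has closed range. *)
Definition mp_inverse A : H -> H := xget 0 [set X | is_mp_inverse A X].

End InnerProduct.

(* Main.v *)
Require Import Defs.
From HB Require Import structures.
From mathcomp Require Import all_boot all_order all_algebra.
From mathcomp Require Import complex ring lra zify.
From mathcomp Require Import all_classical all_reals all_analysis.
Import Order.TTheory GRing.Theory Num.Theory.
Import numFieldNormedType.Exports.
Local Open Scope classical_set_scope.
Local Open Scope ring_scope.

(** Write [E_n = B_n - B], [N_n] and [N] for the nullspaces of [B_n] and [B],
   [P_n] and [Q] for the projections on them, and [X_n], [Y] for the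
   Moore-Penrose inverses.

   The geometric heart is that [N_n] can only be too small. As the range of [B]
   is closed, [B] is bounded below on the orthogonal complement of [N]
   ([closed_range_bounded_below]); a vector [y] of [N_n] satisfies
   [B y = - E_n y], so that for large [n] it is close to [Q y]
   ([nullspace_near_proj]). Hence [Q] is injective on [N_n], with closed image.
   That image is the whole of [N] if and only if no nonzero vector of [N] is
   orthogonal to [N_n] ([nullspace_proj_onto]), which is (vi), and if and only
   if the index of [Q P_n] vanishes, its kernel being trivial
   ([ess_codim_eq0]), which is (i). When [Q] maps [N_n] onto [N], a vector
   orthogonal to [N_n] is almost orthogonal to [N], so that [B_n] is bounded
   below there by a constant that does not depend on [n]
   ([bounded_below_nearby]); this is (ii).

   From (ii) to (iii), Wedin's identity [mp_inverse_sub] expresses [X_n - Y]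
   linearly by [E_n] and its adjoint, with bounded coefficients. The adjoint of
   [E_n] is in the ideal with no larger norm, because the polar decomposition
   yields a contraction [V] such that [adjoint E = V E V]
   ([adjoint_factorization]). The modulus of [E] that this requires is the
   limit of a quadratic iteration ([square_root_1B]).

   From (iii) to (iv), [P_n = 1 - X_n B_n]. From (iv) to (v), the ideal norm
   dominates the operator norm ([opnorm_le_ideal_norm]). From (v) to (vi), a
   vector [x] of [N] orthogonal to [N_n] satisfies [(P_n - Q) x = - x].

   Geometric arguments are carried out with the real part [ip] of the inner
   product. *)

Set Implicit Arguments.
Unset Strict Implicit.

(** * Norms with real values and metric closedness *)

Section NormedSpace.
Local Open Scope complex_scope.
Context {R : realType} {H : completeNormedModType R[i]}.
Implicit Types (x y z : H) (A B C : H -> H) (V W : set H).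

Lemma normE x : `|x| = (rnorm x)%:C.
Proof. by rewrite /rnorm RRe_real // ger0_real. Qed.

Lemma rnorm_ge0 x : 0 <= rnorm x.
Proof. by rewrite -ler0c -normE. Qed.
Hint Extern 0 (is_true (@Order.le _ _ _ (rnorm _))) => exact: rnorm_ge0 : core.

Lemma rnorm0 : rnorm (0 : H) = 0.
Proof. by rewrite /rnorm normr0. Qed.

Lemma rnorm_eq0 x : rnorm x = 0 -> x = 0.
Proof. by move=> h; apply/eqP; rewrite -normr_eq0 normE h. Qed.

Lemma rnorm_gt0 x : x <> 0 -> 0 < rnorm x.
Proof.
move=> x0; rewrite lt_neqAle rnorm_ge0 andbT eq_sym.
by apply/eqP => /rnorm_eq0.
Qed.

Lemma rnormN x : rnorm (- x) = rnorm x.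
Proof. by rewrite /rnorm normrN. Qed.

Lemma rnormBC x y : rnorm (x - y) = rnorm (y - x).
Proof. by rewrite -rnormN opprB. Qed.

Lemma rnormD x y : rnorm (x + y) <= rnorm x + rnorm y.
Proof. by rewrite -lecR rmorphD/= -!normE ler_normD. Qed.

Lemma rnormB x y : rnorm (x - y) <= rnorm x + rnorm y.
Proof. by rewrite -(rnormN y) rnormD. Qed.

Lemma Re_normE (c : R[i]) : (complex.Re `|c|)%:C = `|c|.
Proof. by rewrite RRe_real// ger0_real. Qed.

Lemma rnormZ (c : R[i]) x : rnorm (c *: x) = complex.Re `|c| * rnorm x.
Proof.
apply: (@complexI R); rewrite -[LHS]normE normrZ -[X in X * _]Re_normE normE.
exact/esym/(rmorphM (real_complex R)).
Qed.

Lemma Re_norm_ge0 (c : R[i]) : 0 <= complex.Re `|c|.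
Proof. by rewrite normc_def /= sqrtr_ge0. Qed.

Lemma Re_norm_real (r : R) : complex.Re `|r%:C| = `|r|.
Proof. by rewrite normc_def /= expr0n addr0 sqrtr_sqr. Qed.

Lemma rnormZr (r : R) x : rnorm (r%:C *: x) = `|r| * rnorm x.
Proof. by rewrite rnormZ Re_norm_real. Qed.

Lemma rnorm_triangle x y z : rnorm (x - z) <= rnorm (x - y) + rnorm (y - z).
Proof. by rewrite (_ : x - z = x - y + (y - z)) ?rnormD// addrA subrK. Qed.

Lemma eq_rnorm_small x y : (forall e : R, 0 < e -> rnorm (x - y) < e) -> x = y.
Proof.
move=> h; apply/eqP; rewrite -subr_eq0; apply/eqP/rnorm_eq0.
apply/eqP; rewrite eq_le rnorm_ge0 andbT leNgt; apply/negP => /h.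
by rewrite ltxx.
Qed.

Lemma invS_small (e : R) : 0 < e ->
  exists N, forall n, (N <= n)%N -> n.+1%:R^-1 < e.
Proof.
move=> e0; exists (Num.truncn e^-1) => n Nn.
rewrite -[ltRHS]invrK ltf_pV2 ?posrE ?invr_gt0//.
by apply: lt_le_trans (truncnS_gt _) _; rewrite ler_nat ltnS.
Qed.

(** Closedness tested with radii in [R]; the balls of [H] have theirs in
   [R[i]]. *)
Definition metric_closed V :=
  forall x, (forall e : R, 0 < e -> exists2 v, V v & rnorm (x - v) < e) -> V x.

Lemma closed_metric_closed V : closed V -> metric_closed V.
Proof.
move=> cV x h; apply: cV => U /nbhs_ballP[e /= e0 xU].
have [r re] : exists r : R, e = r%:C.
  by apply/complex_realP; rewrite gtr0_real.
move: e0 xU; rewrite re (ltcR 0) => r0 xU.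
have [v Vv xv] := h _ r0; exists v; split => //; apply: xU.
by rewrite -ball_normE /ball_/= normE ltcR.
Qed.

Definition metric_cvg (u : nat -> H) x :=
  forall e : R, 0 < e -> exists N, forall n, (N <= n)%N -> rnorm (u n - x) < e.

Lemma cauchy_metric_cvg (u : nat -> H) :
  (forall e : R, 0 < e -> exists N, forall m n, (N <= m)%N -> (N <= n)%N ->
     rnorm (u m - u n) < e) ->
  exists x, metric_cvg u x.
Proof.
move=> cu.
have : cvg (u @ \oo).
  suff : cauchy (u @ \oo) by exact: cauchy_cvg.
  suff : cauchy_ex (u @ \oo) by exact: cauchy_exP.
  move=> e e0.
  have [r re] : exists r : R, e = r%:C.
    by apply/complex_realP; rewrite gtr0_real.
  move: e0; rewrite re (ltcR 0) => r0.
  have [N hN] := cu _ r0; exists (u N), N => // n /= Nn.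
  by rewrite -ball_normE /ball_/= normE ltcR; exact: hN.
move=> /cvg_ex[x ux]; exists x => e e0.
have /cvgrPdist_lt/(_ e%:C) := ux.
rewrite (ltcR 0) => /(_ e0)[N _ hN]; exists N => n Nn.
by rewrite rnormBC -ltcR -normE; exact: hN.
Qed.

(** * Bounded operators *)

Lemma add_opE A B x : (A + B) x = A x + B x. Proof. by []. Qed.

Lemma sub_opE A B x : (A - B) x = A x - B x. Proof. by []. Qed.

Lemma opp_opE A x : (- A) x = - A x. Proof. by []. Qed.

Lemma linear_op0 A : linear A -> A 0 = 0.
Proof. by move=> lA; have := lA (-1) 0 0; rewrite scaler0 addr0 scaleN1r addNr. Qed.

Lemma linear_opD A : linear A -> {morph A : x y / x + y}.
Proof. by move=> lA x y; have := lA 1 x y; rewrite !scale1r. Qed.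

Lemma linear_opZ A : linear A -> forall c, {morph A : x / c *: x}.
Proof. by move=> lA c x; have := lA c x 0; rewrite (linear_op0 lA) !addr0. Qed.

Lemma linear_opN A : linear A -> {morph A : x / - x}.
Proof. by move=> lA x; rewrite -scaleN1r (linear_opZ lA) scaleN1r. Qed.

Lemma linear_opB A : linear A -> {morph A : x y / x - y}.
Proof. by move=> lA x y; rewrite linear_opD// linear_opN. Qed.

Lemma bounded_op_of_le A (M : R) : linear A ->
  (forall x, rnorm (A x) <= M * rnorm x) -> bounded_op A.
Proof. by move=> lA h; split => //; exists M. Qed.

Lemma bounded_opP A : bounded_op A ->
  exists2 M : R, 0 <= M & forall x, rnorm (A x) <= M * rnorm x.
Proof.
move=> [lA [M h]]; exists (Num.max 0 M) => [|x]; first by rewrite le_max lexx.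
by apply: le_trans (h x) _; rewrite ler_wpM2r// le_max lexx orbT.
Qed.

Lemma opnorm_has_sup A : bounded_op A ->
  has_sup [set rnorm (A x) | x in [set x | rnorm x <= 1]].
Proof.
move=> /bounded_opP[M M0 h]; split.
  by exists (rnorm (A 0)), 0 => //=; rewrite rnorm0.
exists M => _ [x /= x1 <-]; apply: le_trans (h x) _.
by rewrite -[leRHS]mulr1 ler_wpM2l.
Qed.

Lemma opnorm_ge0 A : bounded_op A -> 0 <= opnorm A.
Proof.
move=> bA; apply: le_trans (rnorm_ge0 (A 0)) _.
apply: ub_le_sup; first by have [] := opnorm_has_sup bA.
by exists 0 => //=; rewrite rnorm0.
Qed.

Lemma opnormP A x : bounded_op A -> rnorm (A x) <= opnorm A * rnorm x.
Proof.
move=> bA; have [->|/eqP/rnorm_gt0 x0] := eqVneq x 0.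
  by rewrite (linear_op0 bA.1) rnorm0 mulr0.
rewrite -ler_pdivrMr//.
apply: ub_le_sup; first by have [] := opnorm_has_sup bA.
exists ((rnorm x)^-1%:C *: x) => /=.
  by rewrite rnormZr ger0_norm ?invr_ge0// mulVf// gt_eqF.
rewrite (linear_opZ bA.1).
by rewrite rnormZr ger0_norm ?invr_ge0// mulrC.
Qed.

Lemma opnorm_le A (M : R) : 0 <= M -> (forall x, rnorm (A x) <= M * rnorm x) ->
  opnorm A <= M.
Proof.
move=> M0 h; apply: ge_sup.
  by exists (rnorm (A 0)), 0 => //=; rewrite rnorm0.
move=> _ [x /= x1 <-]; apply: le_trans (h x) _.
by rewrite -[leRHS]mulr1 ler_wpM2l.
Qed.

Lemma linear_comp A B : linear A -> linear B -> linear (A \o B).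
Proof. by move=> lA lB c x y /=; rewrite lB lA. Qed.

Lemma linear_sub A B : linear A -> linear B -> linear (A - B).
Proof.
by move=> lA lB c x y; rewrite !fctE lB lA scalerBr opprD addrACA.
Qed.

Lemma opnorm_comp A B : bounded_op A -> bounded_op B ->
  forall x, rnorm (A (B x)) <= opnorm A * opnorm B * rnorm x.
Proof.
move=> bA bB x; apply: le_trans (opnormP _ bA) _; rewrite -mulrA.
by apply: ler_wpM2l; [exact: opnorm_ge0|exact: opnormP].
Qed.

Lemma bounded_comp A B : bounded_op A -> bounded_op B -> bounded_op (A \o B).
Proof.
move=> bA bB; apply: (@bounded_op_of_le _ (opnorm A * opnorm B)).
  by case: bA; case: bB => *; exact: linear_comp.
exact: (opnorm_comp bA bB).
Qed.

Lemma bounded_sub A B : bounded_op A -> bounded_op B -> bounded_op (A - B).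
Proof.
move=> bA bB; apply: (@bounded_op_of_le _ (opnorm A + opnorm B)).
  by case: bA; case: bB => *; exact: linear_sub.
move=> x; rewrite !fctE mulrDl; apply: le_trans (rnormB _ _) _.
by rewrite lerD// opnormP.
Qed.

Lemma bounded_id : bounded_op (id : H -> H).
Proof. by apply: (@bounded_op_of_le _ 1) => // x; rewrite mul1r. Qed.

(** * Subspaces *)

Definition linear_subspace V :=
  V 0 /\ forall (c : R[i]) x y, V x -> V y -> V (c *: x + y).

Lemma subspaceZ V (c : R[i]) x : linear_subspace V -> V x -> V (c *: x).
Proof. by move=> [V0 VD] Vx; rewrite -[_ *: _]addr0; exact: VD. Qed.

Lemma subspaceD V x y : linear_subspace V -> V x -> V y -> V (x + y).
Proof. by move=> [V0 VD] Vx Vy; rewrite -[x]scale1r; exact: VD. Qed.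

Lemma subspaceB V x y : linear_subspace V -> V x -> V y -> V (x - y).
Proof.
move=> sV Vx Vy; apply: subspaceD => //.
by rewrite -scaleN1r; exact: subspaceZ.
Qed.

Lemma subspace_nullspace A : linear A -> linear_subspace (nullspace A).
Proof.
move=> lA; split; first exact: linear_op0.
by move=> c x y; rewrite /nullspace/= => Ax Ay; rewrite lA Ax Ay scaler0 addr0.
Qed.

Lemma subspace_image A V : linear A -> linear_subspace V -> linear_subspace (A @` V).
Proof.
move=> lA [V0 VD]; split; first by exists 0 => //; exact: linear_op0.
by move=> c _ _ [x Vx <-] [y Vy <-]; exists (c *: x + y); [exact: VD|rewrite lA].
Qed.

Lemma subspace_range A : linear A -> linear_subspace (range A).
Proof. by move=> lA; apply: subspace_image. Qed.

Lemma nullspace_metric_closed A : bounded_op A -> metric_closed (nullspace A).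
Proof.
move=> bA x h; apply: eq_rnorm_small => e e0; rewrite subr0.
have [lA _] := bA; have A0 := opnorm_ge0 bA.
have d0 : 0 < e / (opnorm A + 1) by rewrite divr_gt0// ltr_wpDl.
have [v Av xv] := h _ d0.
rewrite -[A x]subr0 -Av -(linear_opB lA).
apply: le_lt_trans (opnormP _ bA) _.
rewrite ltr_pdivlMr in xv; last by rewrite ltr_wpDl.
apply: le_lt_trans xv; rewrite mulrC ler_wpM2l// lerDl//.
Qed.

(** Preimages of a Cauchy sequence of values are Cauchy, and so converge. *)
Lemma bounded_below_closed A V (C : R) : bounded_op A -> linear_subspace V ->
  metric_closed V -> (forall x, V x -> rnorm x <= C * rnorm (A x)) ->
  metric_closed (A @` V).
Proof.
move=> bA sV cV hC z hz; have [lA _] := bA.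
have {hz} hz k : exists x, V x /\ rnorm (z - A x) < k.+1%:R^-1.
  have k0 : (0 : R) < k.+1%:R^-1 by rewrite invr_gt0.
  by have [_ [x Vx <-] h] := hz _ k0; exists x.
have [u hu] := choice hz.
have small (e : R) : 0 < e -> exists N : nat, forall n, (N <= n)%N ->
    rnorm (z - A (u n)) < e.
  move=> /invS_small[N hN]; exists N => n Nn.
  exact: lt_trans (hu n).2 (hN n Nn).
have C0 : 0 < `|C| + 1 by rewrite ltr_wpDl.
have [x ux] : exists x, metric_cvg u x.
  apply: cauchy_metric_cvg => e e0.
  have d0 : 0 < e / (`|C| + 1) / 2 by rewrite !divr_gt0.
  have [N hN] := small _ d0; exists N => m n Nm Nn.
  have [Vm _] := hu m; have [Vn _] := hu n.
  have := hC _ (subspaceB sV Vm Vn); rewrite (linear_opB lA) => h.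
  have h2 : rnorm (A (u m) - A (u n)) < e / (`|C| + 1).
    apply: le_lt_trans (rnorm_triangle _ z _) _.
    rewrite [ltRHS]splitr ltrD ?hN//.
    by rewrite rnormBC hN.
  rewrite ltr_pdivlMr// mulrC in h2.
  apply: le_lt_trans h2; apply: le_trans h _.
  by rewrite ler_wpM2r// (le_trans (ler_norm _))// lerDl.
exists x.
  apply: cV => e e0; have [N hN] := ux _ e0.
  exists (u N); first by have [] := hu N.
  by rewrite rnormBC hN.
apply/esym/eq_rnorm_small => e e0; have A0 := opnorm_ge0 bA.
have A1 : 0 < opnorm A + 1 by rewrite ltr_wpDl.
have [|N1 h1] := small (e / 2); first by rewrite divr_gt0.
have [|N2 h2] := ux (e / 2 / (opnorm A + 1)); first by rewrite !divr_gt0.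
pose n := maxn N1 N2.
apply: le_lt_trans (rnorm_triangle _ (A (u n)) _) _.
rewrite [ltRHS]splitr ltrD ?h1 ?leq_maxl// -(linear_opB lA).
apply: le_lt_trans (opnormP _ bA) _.
have := h2 n (leq_maxr _ _); rewrite ltr_pdivlMr//.
by apply: le_lt_trans; rewrite mulrC ler_wpM2l// lerDl.
Qed.

End NormedSpace.
#[local]
Hint Extern 0 (is_true (@Order.le _ _ _ (rnorm _))) => exact: rnorm_ge0 : core.

(** * Relative dimension zero *)

Section Dimension.
Local Open Scope complex_scope.
Context {R : realType} {H : completeNormedModType R[i]}.

Lemma has_dim_mod_refl (V : set H) n : V 0 -> has_dim_mod V V n -> n = 0%N.
Proof.
move=> V0 [u [span free]]; case: n u span free => // n u span free.
have sum1 (i : 'I_n.+1) : \sum_j ((j == i)%:R : R[i]) *: u j = u i.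
  rewrite (bigD1 i)//= eqxx scale1r big1 ?addr0// => j /negPf ->.
  by rewrite scale0r.
have Vu : V (u ord0).
  apply/span; exists 0, (fun j => (j == ord0)%:R); split => //.
  by rewrite add0r sum1.
have := free (fun j => (j == ord0)%:R); rewrite sum1 => /(_ Vu ord0)/eqP.
by rewrite eqxx oner_eq0.
Qed.

Lemma has_dim_mod0 (V W : set H) : has_dim_mod V W 0 <-> V = W.
Proof.
split=> [[u [span _]]|->].
  apply/seteqP; split=> x.
    by move=> /span[w [c [Ww ->]]]; rewrite big_ord0 addr0.
  by move=> Wx; apply/span; exists x, (fun=> 0); rewrite big_ord0 addr0.
exists (fun=> 0); split=> [x|c _ []//]; split=> [Wx|[w [c [Ww ->]]]].
  by exists x, (fun=> 0); rewrite big_ord0 addr0.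
by rewrite big_ord0 addr0.
Qed.

Lemma dim_mod_refl (V : set H) : V 0 -> dim_mod V V = 0%N.
Proof.
move=> V0; apply: (@has_dim_mod_refl V) => //.
have := @xgetPex _ 0%N [set n | has_dim_mod V V n]; apply.
by exists 0%N; exact/has_dim_mod0.
Qed.

End Dimension.

(** * The real inner product *)

Section InnerProduct.
Local Open Scope complex_scope.
Context {R : realType} {H : completeNormedModType R[i]}.
Context (dot : {dot H for (@Num.conj R[i])}).
Hypothesis dot_norm : inner_product_norm dot.
Implicit Types (x y z u v w : H) (A B C X P : H -> H) (V W : set H).

(** The real part of the inner product carries all the information, by
   [dot_ip] below, and makes the geometry that of a real Hilbert space. *)
Definition ip x y : R := complex.Re (dot x y).

Lemma Re_conj (a : R[i]) : complex.Re a^*%C = complex.Re a.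
Proof. by case: a. Qed.

Lemma ReN (a : R[i]) : complex.Re (- a) = - complex.Re a.
Proof. by case: a. Qed.

Lemma ReMr (r : R) (a : R[i]) : complex.Re (r%:C * a) = r * complex.Re a.
Proof. by case: a => u v; simpc. Qed.

Lemma ReMNi (a : R[i]) : complex.Re ('i%C^*%C * a) = complex.Im a.
Proof. by case: a => u v; simpc. Qed.

Lemma ReD (a b : R[i]) : complex.Re (a + b) = complex.Re a + complex.Re b.
Proof. by case: a b => [? ?] [? ?]. Qed.

Lemma dotC x y : dot y x = (dot x y)^*%C.
Proof. by rewrite (hermC dot y x) /= expr0 mul1r. Qed.

Lemma ipC x y : ip x y = ip y x.
Proof. by rewrite /ip (dotC x y) Re_conj. Qed.

Lemma ipDl z x y : ip (x + y) z = ip x z + ip y z.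
Proof. by rewrite /ip linearDl ReD. Qed.

Lemma ipNl y x : ip (- x) y = - ip x y.
Proof. by rewrite /ip linearNl ReN. Qed.

Lemma ipBl z x y : ip (x - y) z = ip x z - ip y z.
Proof. by rewrite ipDl ipNl. Qed.

Lemma ipDr z x y : ip z (x + y) = ip z x + ip z y.
Proof. by rewrite !(ipC z) ipDl. Qed.

Lemma ipNr y x : ip y (- x) = - ip y x.
Proof. by rewrite !(ipC y) ipNl. Qed.

Lemma ipBr z x y : ip z (x - y) = ip z x - ip z y.
Proof. by rewrite ipDr ipNr. Qed.

Lemma ip_adjZ (c : R[i]) x y : ip (c *: x) y = ip x (c^*%C *: y).
Proof.
rewrite /ip linearZl_LR linearZr_LR/=.
by have -> : Num.conj (c^*%C) = c := conjcK c.
Qed.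

Lemma ipZl (r : R) x y : ip (r%:C *: x) y = r * ip x y.
Proof. by rewrite /ip linearZl_LR ReMr. Qed.

Lemma ipZr (r : R) x y : ip x (r%:C *: y) = r * ip x y.
Proof. by rewrite ipC ipZl ipC. Qed.

Lemma ip0l y : ip 0 y = 0.
Proof. by rewrite -(subrr 0) ipBl subrr. Qed.

Lemma ip0r y : ip y 0 = 0.
Proof. by rewrite ipC ip0l. Qed.

Lemma ip_norm x : ip x x = rnorm x ^+ 2.
Proof. by rewrite /ip -dot_norm normE -rmorphXn. Qed.

Lemma dot_ip x y : dot x y = ip x y +i* ip x ('i%C *: y).
Proof.
rewrite /ip linearZr_LR/= (ReMNi (dot x y)).
by case: (dot x y).
Qed.

Lemma ip_eq0 x : ip x x = 0 -> x = 0.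
Proof. by rewrite ip_norm => /eqP; rewrite sqrf_eq0 => /eqP/rnorm_eq0. Qed.

Lemma ip_ext x y : (forall z, ip x z = ip y z) -> x = y.
Proof.
by move=> h; apply/eqP; rewrite -subr_eq0; apply/eqP/ip_eq0; rewrite ipBl h subrr.
Qed.

Lemma rnormD_sqr x y :
  rnorm (x + y) ^+ 2 = rnorm x ^+ 2 + 2 * ip x y + rnorm y ^+ 2.
Proof. by rewrite -!ip_norm ipDl !ipDr (ipC y x); ring. Qed.

Lemma rnormB_sqr x y :
  rnorm (x - y) ^+ 2 = rnorm x ^+ 2 - 2 * ip x y + rnorm y ^+ 2.
Proof. by rewrite rnormD_sqr ipNr rnormN; ring. Qed.

Lemma parallelogram x y :
  rnorm (x + y) ^+ 2 + rnorm (x - y) ^+ 2 = 2 * rnorm x ^+ 2 + 2 * rnorm y ^+ 2.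
Proof. by rewrite rnormD_sqr rnormB_sqr; ring. Qed.

Lemma cauchy_schwarz x y : ip x y <= rnorm x * rnorm y.
Proof.
have [->|/eqP/rnorm_gt0 x0] := eqVneq x 0; first by rewrite ip0l rnorm0 mul0r.
have [->|/eqP/rnorm_gt0 y0] := eqVneq y 0; first by rewrite ip0r rnorm0 mulr0.
have := sqr_ge0 (rnorm ((rnorm y)%:C *: x - (rnorm x)%:C *: y)).
rewrite rnormB_sqr ipZl ipZr !rnormZr !(ger0_norm (rnorm_ge0 _)) => h.
have {h} : 0 <= 2 * (rnorm x * rnorm y) * (rnorm x * rnorm y - ip x y).
  by apply: le_trans h _; rewrite le_eqVlt; apply/orP; left; apply/eqP; ring.
by rewrite pmulr_rge0 ?subr_ge0// !mulr_gt0.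
Qed.

Lemma cauchy_schwarz_norm x y : `|ip x y| <= rnorm x * rnorm y.
Proof.
rewrite ler_norml cauchy_schwarz andbT lerNl -ipNl.
by apply: le_trans (cauchy_schwarz _ _) _; rewrite rnormN.
Qed.

(** Riesz representation is needed for real-linear functionals, the kernels of
   which are not stable under complex scalars. *)
Definition real_subspace V :=
  V 0 /\ forall (r : R) x y, V x -> V y -> V (r%:C *: x + y).

Lemma real_subspaceW V : linear_subspace V -> real_subspace V.
Proof. by move=> [V0 VD]; split => // r x y; exact: VD. Qed.

(** A minimizing sequence for the distance to [V] is Cauchy by the
   parallelogram identity, and its limit is the projection. *)
Lemma projection_exists V x : real_subspace V -> metric_closed V ->
  exists2 p, V p & forall v, V v -> ip (x - p) v = 0.
Proof.
move=> sV cV; have [V0 VD] := sV.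
pose D := [set rnorm (x - v) | v in V]; pose d := inf D.
have D0 : has_inf D.
  split; first by exists (rnorm (x - 0)), 0.
  by exists 0 => _ [v _ <-].
have d_ge0 : 0 <= d by apply: lb_le_inf; [case: D0|move=> _ [v _ <-]].
have dle v : V v -> d <= rnorm (x - v).
  by move=> Vv; apply: ge_inf; [case: D0|exists v].
have close (e : R) : 0 < e -> exists2 v, V v & rnorm (x - v) ^+ 2 < d ^+ 2 + e.
  move=> e0; pose f := Num.sqrt (d ^+ 2 + e) - d.
  have f0 : 0 < f.
    rewrite subr_gt0 -[ltLHS](ger0_norm d_ge0) -sqrtr_sqr ltr_sqrt ?ltrDl//.
    by rewrite ltr_wpDl// sqr_ge0.
  have [_ [v Vv <-] h] := inf_adherent f0 D0.
  exists v => //; rewrite -/d /f addrCA subrr addr0 in h.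
  rewrite -[ltRHS]sqr_sqrtr; last by rewrite addr_ge0// ?sqr_ge0// ltW.
  by rewrite ltr_pXn2r ?nnegrE ?sqrtr_ge0.
have pair v w (e : R) : V v -> V w -> rnorm (x - v) ^+ 2 < d ^+ 2 + e ->
    rnorm (x - w) ^+ 2 < d ^+ 2 + e -> rnorm (v - w) ^+ 2 < 4 * e.
  move=> Vv Vw hv hw.
  have := parallelogram (x - v) (x - w).
  rewrite (_ : x - v - (x - w) = w - v); last by rewrite opprB addrC addrA subrK.
  rewrite (rnormBC v w).
  have -> : x - v + (x - w) = 2%:C *: (x - (2^-1%:C *: v + 2^-1%:C *: w)).
    rewrite scalerBr scalerDr !scalerA -rmorphM/= divff// !scale1r.
    by rewrite rmorph_nat scaler_nat mulr2n opprD addrACA.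
  rewrite rnormZr normr_nat => h.
  have Vm : V (2^-1%:C *: v + 2^-1%:C *: w).
    by apply: (VD) => //; rewrite -[_ *: w]addr0; exact: VD.
  have := dle _ Vm; set t := rnorm (x - (_ + _)) in h * => dt.
  have t2 : d ^+ 2 <= t ^+ 2 by rewrite ler_pXn2r ?nnegrE// (le_trans d_ge0).
  move: h; rewrite exprMn => h; lra.
have hs k : exists v, V v /\ rnorm (x - v) ^+ 2 < d ^+ 2 + k.+1%:R^-1.
  by have [|v Vv hv] := close k.+1%:R^-1; [rewrite invr_gt0|exists v].
have [u hu] := choice hs.
have small (e : R) : 0 < e -> exists N : nat, forall n, (N <= n)%N ->
    rnorm (x - u n) ^+ 2 < d ^+ 2 + e.
  move=> /invS_small[N hN]; exists N => n Nn.
  by apply: lt_trans (hu n).2 _; rewrite ltrD2l hN.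
have [p up] : exists p, metric_cvg u p.
  apply: cauchy_metric_cvg => e e0.
  have e2 : 0 < e ^+ 2 / 4 by rewrite divr_gt0// exprn_gt0.
  have [N hN] := small _ e2; exists N => m n Nm Nn.
  have := pair _ _ _ (proj1 (hu m)) (proj1 (hu n)) (hN _ Nm) (hN _ Nn).
  rewrite mulrCA divff// mulr1 ltr_pXn2r ?nnegrE//.
  exact: ltW.
have Vp : V p.
  apply: cV => e e0; have [N hN] := up _ e0.
  exists (u N); first by have [] := hu N.
  by rewrite rnormBC hN.
have pd : rnorm (x - p) <= d.
  apply/ler_addgt0Pr => e e0.
  have f0 : 0 < (e / 2) ^+ 2 by rewrite exprn_gt0// divr_gt0.
  have e2 : 0 < e / 2 by rewrite divr_gt0.
  have [N1 h1] := small _ f0; have [N2 h2] := up _ e2.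
  pose n := maxn N1 N2.
  apply: le_trans (rnorm_triangle _ (u n) _) _.
  rewrite [X in d + X]splitr addrA lerD//; last by rewrite ltW// h2// leq_maxr.
  rewrite -(@ler_pXn2r _ 2)// ?nnegrE ?addr_ge0// ?(ltW e2)//.
  apply: le_trans (ltW (h1 n (leq_maxl _ _))) _.
  have := mulr_ge0 d_ge0 (ltW e2); nra.
exists p => // v Vv.
have [->|/eqP/rnorm_gt0 v0] := eqVneq v 0; first by rewrite ip0r.
(* p + t v is the point nearest to x on the line through p along v *)
pose t := ip (x - p) v / rnorm v ^+ 2.
have Vq : V (t%:C *: v + p) by apply: VD.
have := dle _ Vq; rewrite (addrC _ p) opprD addrA => h.
have := le_trans pd h; rewrite -(@ler_pXn2r _ 2)// ?nnegrE// => {}h.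
rewrite (rnormB_sqr (x - p)) ipZr rnormZr exprMn (real_normK (num_real t)) in h.
have v2 : rnorm v ^+ 2 != 0 by rewrite expf_neq0// gt_eqF.
have {h} : t ^+ 2 * rnorm v ^+ 2 <= 0.
  have e : t * ip (x - p) v = t ^+ 2 * rnorm v ^+ 2.
    by rewrite /t; field; rewrite -sqrf_eq0.
  by move: h; rewrite e; lra.
rewrite pmulr_lle0 ?exprn_gt0// => t2.
have /eqP : t ^+ 2 = 0 by apply/eqP; rewrite eq_le t2 sqr_ge0.
rewrite sqrf_eq0 mulf_eq0 invr_eq0 (negPf v2) orbF.
by move/eqP.
Qed.

End InnerProduct.

(** * Orthogonal projections and adjoints *)

Section Adjoint.
Local Open Scope complex_scope.
Context {R : realType} {H : completeNormedModType R[i]}.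
Context (dot : {dot H for (@Num.conj R[i])}).
Hypothesis dot_norm : inner_product_norm dot.
Implicit Types (x y z u v w : H) (A B C X P : H -> H) (V W : set H).
Local Notation ip := (ip dot).

Definition perp V x := forall v, V v -> ip x v = 0.

Lemma orthogonal_complE V x :
  linear_subspace V -> (orthogonal_compl dot V x <-> perp V x).
Proof.
move=> sV; split=> h v Vv; first by rewrite /ip h.
by rewrite dot_ip !h//; exact: subspaceZ.
Qed.

Lemma perpB V x y : perp V x -> perp V y -> perp V (x - y).
Proof. by move=> hx hy v Vv; rewrite ipBl hx// hy// subrr. Qed.

Lemma linear_subspace_perp V : linear_subspace V -> linear_subspace (perp V).
Proof.
move=> sV; split=> [v _|c x y hx hy v Vv]; first by rewrite ip0l.
by rewrite ipDl ip_adjZ hx ?hy ?addr0//; exact: subspaceZ.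
Qed.

Lemma perp_self V x : V x -> perp V x -> x = 0.
Proof. by move=> Vx /(_ _ Vx) /(ip_eq0 dot_norm). Qed.

Lemma projection_unique V x p q : linear_subspace V ->
  V p -> perp V (x - p) -> V q -> perp V (x - q) -> p = q.
Proof.
move=> sV Vp hp Vq hq; apply/eqP; rewrite -subr_eq0; apply/eqP.
apply: (@perp_self V); first exact: subspaceB.
have -> : p - q = (x - q) - (x - p) by rewrite opprB [RHS]addrC addrA subrK.
exact: perpB.
Qed.

(** A symmetric idempotent is a contraction, being an orthogonal projection. *)
Lemma rnorm_projection P x : (forall x y, ip (P x) y = ip x (P y)) ->
  (forall x, P (P x) = P x) -> rnorm (P x) <= rnorm x.
Proof.
move=> sP iP; have [->//|/eqP/rnorm_gt0 p0] := eqVneq (P x) 0.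
  by rewrite rnorm0.
rewrite -(ler_pM2r p0) -expr2 -(ip_norm dot_norm) sP iP.
exact: cauchy_schwarz.
Qed.

Lemma orth_projP V : linear_subspace V -> metric_closed V ->
  bounded_op (orth_proj dot V) /\
  forall x, V (orth_proj dot V x) /\ perp V (x - orth_proj dot V x).
Proof.
move=> sV cV.
have /choice[P hP] x : exists p, V p /\ perp V (x - p).
  by have [p ? ?] := projection_exists dot_norm x (real_subspaceW sV) cV; exists p.
have lP : linear P.
  move=> c x y; have [VPx hx] := hP x; have [VPy hy] := hP y.
  have [VP h] := hP (c *: x + y).
  apply: (projection_unique sV VP h); first by apply sV.2.
  rewrite opprD addrACA -scalerBr.
  by apply (linear_subspace_perp sV).2.
have fix_ x : V x -> P x = x.
  move=> Vx; have [VPx h] := hP x.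
  apply: (projection_unique sV VPx h Vx) => v _.
  by rewrite subrr ip0l.
have sym x y : ip (P x) y = ip x (P y).
  have [VPx hx] := hP x; have [VPy hy] := hP y.
  apply/eqP; rewrite -subr_eq0; apply/eqP.
  transitivity (ip (P x) (y - P y) - ip (x - P x) (P y)).
    by rewrite ipBr ipBl; ring.
  by rewrite [X in X - _]ipC hx// hy// subrr.
have bP : bounded_op P.
  apply: (@bounded_op_of_le _ _ _ 1) => // x; rewrite mul1r.
  by apply: rnorm_projection => // {}x; apply: fix_; case: (hP x).
have := @xgetPex _ 0 [set P | bounded_op P /\
    forall x, V (P x) /\ orthogonal_compl dot V (x - P x)].
rewrite -/(orth_proj dot V) => -[].
  exists P; split => // x; have [? ?] := hP x; split => //.
  exact/(orthogonal_complE _ sV).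
move=> bQ hQ; split => // x; have [? ?] := hQ x; split => //.
exact/(orthogonal_complE _ sV).
Qed.

Lemma orth_proj_eq V x p : linear_subspace V -> metric_closed V ->
  V p -> perp V (x - p) -> orth_proj dot V x = p.
Proof.
move=> sV cV Vp hp; have [_ /(_ x)[VP hP]] := orth_projP sV cV.
exact: (projection_unique sV VP hP).
Qed.

Lemma orth_proj_id V x : linear_subspace V -> metric_closed V ->
  V x -> orth_proj dot V x = x.
Proof. by move=> sV cV Vx; apply: orth_proj_eq => // v _; rewrite subrr ip0l. Qed.

Lemma orth_proj_sym V x y : linear_subspace V -> metric_closed V ->
  ip (orth_proj dot V x) y = ip x (orth_proj dot V y).
Proof.
move=> sV cV; have [_ hP] := orth_projP sV cV.
set P := orth_proj dot V in hP *.
apply/eqP; rewrite -subr_eq0; apply/eqP.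
transitivity (ip (P x) (y - P y) - ip (x - P x) (P y)).
  by rewrite ipBr ipBl; ring.
by rewrite [X in X - _]ipC ((hP y).2 _ (hP x).1) ((hP x).2 _ (hP y).1) subrr.
Qed.

Lemma orth_proj_le V x : linear_subspace V -> metric_closed V ->
  rnorm (orth_proj dot V x) <= rnorm x.
Proof.
move=> sV cV; apply: rnorm_projection => [{}x y|{}x]; first exact: orth_proj_sym.
by apply: orth_proj_id => //; have [_ /(_ x)[]] := orth_projP sV cV.
Qed.

Lemma range_orth_proj V : linear_subspace V -> metric_closed V ->
  range (orth_proj dot V) = V.
Proof.
move=> sV cV; have [_ hP] := orth_projP sV cV; apply/seteqP; split=> x.
  by move=> [y _ <-]; exact: (hP y).1.
by move=> Vx; exists x => //; exact: orth_proj_id.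
Qed.

(** Unless [f] is zero, the orthogonal complement of its kernel is a real line,
   and [z] is a multiple of any nonzero vector [w] on it. *)
Lemma riesz (f : H -> R) (M : R) :
  (forall (r : R) x y, f (r%:C *: x + y) = r * f x + f y) ->
  (forall x, `|f x| <= M * rnorm x) ->
  exists z, forall x, f x = ip x z.
Proof.
move=> lf bf.
have f0 : f 0 = 0.
  have := lf (-1) 0 0; rewrite scaler0 add0r mulN1r addNr.
  by [].
have fZ r x : f (r%:C *: x) = r * f x by have := lf r x 0; rewrite !addr0 f0 addr0.
have fB x y : f (x - y) = f x - f y.
  have := lf (-1) y x; rewrite rmorphN1 scaleN1r addrC => ->.
  by rewrite mulN1r addrC.
pose K := [set x | f x = 0].
have sK : real_subspace K.
  by split => // r x y; rewrite /K/= lf => -> ->; rewrite mulr0 addr0.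
have cK : metric_closed K.
  move=> x h; apply/eqP; rewrite -normr_eq0 eq_le normr_ge0 andbT.
  apply/ler_addgt0Pr => e e0; rewrite add0r.
  have M0 : 0 < `|M| + 1 by rewrite ltr_wpDl.
  have [|v Kv hv] := h (e / (`|M| + 1)); first by rewrite divr_gt0.
  rewrite -[f x]subr0 -Kv -fB; apply: le_trans (bf _) _.
  move: hv; rewrite ltr_pdivlMr// => /ltW; apply: le_trans.
  by rewrite mulrC ler_wpM2l// (le_trans (ler_norm _))// lerDl.
have [f00|/existsNP[u fu]] := pselect (forall x, f x = 0).
  by exists 0 => x; rewrite f00 ip0r.
have [p Kp hp] := projection_exists dot_norm u sK cK.
pose w := u - p; have {}hp : perp K w := hp.
have fw : f w <> 0 by rewrite /w fB Kp subr0.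
have w0 : ip w w != 0.
  by apply/eqP => /(ip_eq0 dot_norm) w0; apply: fw; rewrite w0.
exists ((f w / ip w w)%:C *: w) => x.
have : K (x - (f x / f w)%:C *: w).
  by rewrite /K/= fB fZ divfK ?subrr//; exact/eqP.
move=> /hp; rewrite ipC ipBl ipZl => /eqP; rewrite subr_eq0 => /eqP h.
rewrite ipZr h; field.
by apply/andP; split; [exact/eqP|exact: w0].
Qed.

Lemma rnorm_le_of_ip (M : R) y : 0 <= M -> ip y y <= M * rnorm y -> rnorm y <= M.
Proof.
move=> M0; have [->|/eqP/rnorm_gt0 y0] := eqVneq y 0; first by rewrite rnorm0.
by rewrite (ip_norm dot_norm) expr2 ler_pM2r.
Qed.

Lemma adjoint_exists A : bounded_op A -> exists X, bounded_op X /\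
  forall x y, ip (A x) y = ip x (X y).
Proof.
move=> bA; have [lA _] := bA; have A0 := opnorm_ge0 bA.
have /choice[X hX] y : exists z, forall x, ip (A x) y = ip x z.
  apply: (@riesz _ (opnorm A * rnorm y)) => [r u v|u].
    by rewrite lA ipDl ipZl.
  apply: le_trans (cauchy_schwarz_norm dot_norm _ _) _.
  by rewrite mulrAC ler_wpM2r// opnormP.
exists X; split; last by [].
apply: (@bounded_op_of_le _ _ _ (opnorm A)) => [c x y|y].
  apply: (ip_ext dot_norm) => z; rewrite ipDl ip_adjZ ![ip _ z]ipC ![ip (X _) _]ipC.
  by rewrite -!hX ipDr (linear_opZ lA) [RHS]addrC [ip (_ *: A z) x]ipC -ip_adjZ ipC addrC.
apply: rnorm_le_of_ip; first by rewrite mulr_ge0.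
rewrite -hX; apply: le_trans (cauchy_schwarz dot_norm _ _) _.
by rewrite mulrAC ler_wpM2r// opnormP.
Qed.

Definition adjoint A : H -> H :=
  xget 0 [set X | bounded_op X /\ forall x y, ip (A x) y = ip x (X y)].

Lemma adjoint_bounded A : bounded_op A -> bounded_op (adjoint A).
Proof. by move=> /adjoint_exists /xgetPex-/(_ 0)[]. Qed.

Lemma adjointP A x y : bounded_op A -> ip (A x) y = ip x (adjoint A y).
Proof. by move=> /adjoint_exists /xgetPex-/(_ 0)[_ h]; exact: h. Qed.

Lemma adjointPV A x y : bounded_op A -> ip (adjoint A x) y = ip x (A y).
Proof. by move=> bA; rewrite ipC -adjointP// ipC. Qed.

Lemma opnorm_adjoint A : bounded_op A -> opnorm (adjoint A) <= opnorm A.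
Proof.
move=> bA; have A0 := opnorm_ge0 bA; apply: opnorm_le => // y.
apply: rnorm_le_of_ip; first by rewrite mulr_ge0.
rewrite -adjointP//; apply: le_trans (cauchy_schwarz dot_norm _ _) _.
by rewrite mulrAC ler_wpM2r// opnormP.
Qed.

Lemma self_adjoint_ip A : bounded_op A ->
  (self_adjoint dot A <-> forall x y, ip (A x) y = ip x (A y)).
Proof.
move=> [lA _]; split=> h x y; first by rewrite /ip h.
by rewrite !dot_ip !h (linear_opZ lA).
Qed.

End Adjoint.

(** * Uniform boundedness *)

Section UniformBoundedness.
Local Open Scope complex_scope.
Context {R : realType} {H : completeNormedModType R[i]}.
Context (dot : {dot H for (@Num.conj R[i])}).
Hypothesis dot_norm : inner_product_norm dot.
Implicit Types (x y z u v w : H) (A B C X P : H -> H) (V W : set H).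
Local Notation ip := (ip dot).
Local Notation adjoint := (adjoint dot).
Local Notation perp := (perp dot).

(** The gliding hump: were [Y] unbounded, signed multiples of elements of [Y]
   of norms [3 ^- n] would add up to a vector with unbounded products with
   elements of [Y]; the tail after the n-th term has half the norm of that
   term, and so cannot cancel its contribution. *)
Lemma weakly_bounded_bounded (Y : set H) :
  (forall w, exists M : R, forall y, Y y -> `|ip w y| <= M) ->
  exists M : R, forall y, Y y -> rnorm y <= M.
Proof.
move=> wb; apply: contrapT => nb.
pose t n : R := 3^-1 ^+ n.
have t0 n : 0 < t n by rewrite exprn_gt0// invr_gt0.
have tS n : 3 * t n.+1 = t n by rewrite /t exprS mulrA divff// mul1r.
have /choice[y hy] n : exists y, Y y /\ n%:R / t n < rnorm y.
  apply: contrapT => h; apply: nb; exists (n%:R / t n) => y Yy.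
  by rewrite leNgt; apply/negP => hy; apply: h; exists y.
have y0 n : 0 < rnorm (y n).
  by apply: le_lt_trans (hy n).2; rewrite divr_ge0// ltW.
pose step n x := ((-1) ^+ (ip x (y n) < 0)%R * t n / rnorm (y n))%:C *: y n.
pose x := fix x n := if n is m.+1 then x m + step m (x m) else 0.
have normstep n : rnorm (x n.+1 - x n) = t n.
  rewrite /= addrAC subrr add0r rnormZr !normrM normr_sign mul1r normfV.
  by rewrite !gtr0_norm// divfK// gt_eqF.
have big n : t n * rnorm (y n) <= `|ip (x n.+1) (y n)|.
  rewrite /= ipDl ipZl (ip_norm dot_norm).
  set a := ip _ _; set b := (X in _ <= `|_ + X|).
  have -> : b = (-1) ^+ (a < 0)%R * (t n * rnorm (y n)).
    by rewrite /b expr2 mulrA divfK ?gt_eqF// mulrA.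
  have p0 : 0 <= t n * rnorm (y n) by rewrite mulr_ge0// ltW.
  case: ltP => a0; rewrite ?expr0 ?expr1 ?mul1r ?mulN1r.
    by rewrite ler0_norm; lra.
  by rewrite ger0_norm; lra.
have tail n k : rnorm (x (n + k)%N - x n) <= 3 / 2 * t n - 3 / 2 * t (n + k)%N.
  elim: k => [|k IH]; first by rewrite addn0 !subrr rnorm0.
  apply: le_trans (rnorm_triangle _ (x (n + k)%N) _) _.
  rewrite addnS normstep; have := tS (n + k)%N; lra.
have tsmall (e : R) : 0 < e -> exists n, t n < e.
  move=> e0; exists (Num.truncn e^-1).+1.
  have : forall n, t n * n.+1%:R <= 1.
    elim=> [|n IH]; first by rewrite /t expr0 mul1r.
    apply: le_trans IH; rewrite -(tS n) [3 * _]mulrC -mulrA ler_pM2l//.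
    by rewrite -natrM ler_nat; lia.
  set m := (Num.truncn e^-1).+1 => /(_ m) h.
  have m0 : 0 < m.+1%:R :> R by [].
  rewrite -ler_pdivlMr// in h; apply: le_lt_trans h _.
  rewrite mul1r -[ltRHS]invrK ltf_pV2 ?posrE ?invr_gt0//.
  by apply: lt_le_trans (truncnS_gt _) _; rewrite ler_nat.
have [z xz] : exists z, metric_cvg x z.
  apply: cauchy_metric_cvg => e e0.
  have [|N hN] := tsmall (e / 3); first by rewrite divr_gt0.
  exists N => m n Nm Nn.
  apply: le_lt_trans (rnorm_triangle _ (x N) _) _; rewrite [X in _ + X]rnormBC.
  have := tail N (m - N)%N; have := tail N (n - N)%N; rewrite !subnKC//.
  by have := t0 m; have := t0 n; move: hN; rewrite ltr_pdivlMr//; lra.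
have [M hM] := wb z.
(* the product with y n is at least n / 2, whence this choice of n *)
pose n := (Num.truncn (2 * M)).+1.
have hz : rnorm (z - x n.+1) <= t n / 2.
  apply/ler_addgt0Pr => e e0; have [N hN] := xz _ e0.
  apply: le_trans (rnorm_triangle _ (x (n.+1 + N)%N) _) _.
  have := hN _ (leq_addl n.+1 N); have := tail n.+1 N.
  by rewrite rnormBC; have := tS n; have := t0 (n.+1 + N)%N; lra.
have h1 := hM _ (hy n).1; have h2 := big n.
have h3 : `|ip (z - x n.+1) (y n)| <= t n / 2 * rnorm (y n).
  apply: le_trans (cauchy_schwarz_norm dot_norm _ _) _.
  by rewrite ler_wpM2r.
have h4 : `|ip (x n.+1) (y n)| <= `|ip z (y n)| + `|ip (z - x n.+1) (y n)|.
  rewrite ipBl; set a := ip z _; set b := ip _ _.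
  by rewrite -{1}[b](subKr a); exact: ler_normB.
have h5 := (hy n).2; rewrite ltr_pdivrMr// in h5.
have h6 : 2 * M < n%:R by exact: truncnS_gt.
move: h1 h2 h3 h4 h5 h6; rewrite mulrAC [rnorm _ * _]mulrC; lra.
Qed.

End UniformBoundedness.

(** * Closed range and the Moore-Penrose inverse *)

Section MoorePenrose.
Local Open Scope complex_scope.
Context {R : realType} {H : completeNormedModType R[i]}.
Context (dot : {dot H for (@Num.conj R[i])}).
Hypothesis dot_norm : inner_product_norm dot.
Implicit Types (x y z u v w : H) (A B C X P : H -> H) (V W : set H).
Local Notation ip := (ip dot).
Local Notation adjoint := (adjoint dot).
Local Notation perp := (perp dot).

(** With [Y] the set of [y] in the range with [adjoint A y] in the unit ball,
   every [w] has bounded products with [Y], because only the component [A x] of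
   [w] in the closed range contributes, by [ip x (adjoint A y)]. *)
Lemma adjoint_bounded_below A : closed_range_op A ->
  exists2 C : R, 0 <= C &
    forall y, range A y -> rnorm y <= C * rnorm (adjoint A y).
Proof.
move=> [bA cR]; have [lA _] := bA; have bX := adjoint_bounded dot_norm bA.
have sR := subspace_range lA; have mR := closed_metric_closed cR.
pose Y := [set y | range A y /\ rnorm (adjoint A y) <= 1].
have [w|M hM] := @weakly_bounded_bounded _ _ _ dot_norm Y.
  have [p [x _ <-] hp] := projection_exists dot_norm w (real_subspaceW sR) mR.
  exists (rnorm x) => y [Ry y1]; rewrite -[w](subrK (A x)) ipDl hp// add0r.
  rewrite (adjointP dot_norm)//; apply: le_trans (cauchy_schwarz_norm dot_norm _ _) _.
  by rewrite -[leRHS]mulr1 ler_wpM2l.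
exists (Num.max 0 M) => [|y Ry]; first by rewrite le_max lexx.
have [z|/eqP/rnorm_gt0 z0] := eqVneq (adjoint A y) 0.
  have [x _ xy] := Ry.
  have /(ip_eq0 dot_norm) -> : ip y y = 0.
    by rewrite -{1}xy (adjointP dot_norm)// z ip0r.
  by rewrite rnorm0 mulr_ge0// le_max lexx.
have := hM ((rnorm (adjoint A y))^-1%:C *: y); rewrite rnormZr.
rewrite ger0_norm ?invr_ge0// ler_pdivrMl// => h.
apply: le_trans (h _) _; last by rewrite mulrC ler_wpM2r// le_max lexx orbT.
split; first exact: subspaceZ.
rewrite (linear_opZ bX.1) rnormZr ger0_norm ?invr_ge0// mulVf//.
by rewrite gt_eqF.
Qed.

(** The previous bound makes the image of the range of [A] under the adjoint
   closed, hence equal to the orthogonal complement of the nullspace; writing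
   [x = adjoint A y] there, [rnorm x ^+ 2 = ip (A x) y]. *)
Lemma closed_range_bounded_below A : closed_range_op A ->
  exists2 C : R, 0 <= C &
    forall x, perp (nullspace A) x -> rnorm x <= C * rnorm (A x).
Proof.
move=> cA; have [C C0 hC] := adjoint_bounded_below cA.
move: cA => [bA cR]; have [lA _] := bA; have bX := adjoint_bounded dot_norm bA.
have sR := subspace_range lA; have mR := closed_metric_closed cR.
have sW := subspace_image bX.1 sR.
have cW := bounded_below_closed bX sR mR hC.
exists C => // x xN.
have [_ [y Ry <-] hy] := projection_exists dot_norm x (real_subspaceW sW) cW.
have xy : x = adjoint A y.
  apply/eqP; rewrite -subr_eq0; apply/eqP; set r := x - _ in hy *.
  have Ar : A r = 0.
    apply: (ip_eq0 dot_norm); rewrite (adjointP dot_norm)//.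
    by apply: hy; exists (A r) => //; exists r.
  apply: (ip_eq0 dot_norm); rewrite /r ipBl -/r.
  by rewrite (xN r Ar) (adjointPV dot_norm)// Ar ip0r subrr.
apply: (rnorm_le_of_ip dot_norm); first by rewrite mulr_ge0.
rewrite {2}xy -(adjointP dot_norm)//.
apply: le_trans (cauchy_schwarz dot_norm _ _) _.
rewrite [C * _]mulrC -mulrA ler_wpM2l//.
by rewrite xy; exact: hC.
Qed.

(** [X y] is the solution orthogonal to the nullspace of the equation [A x = p],
   where [p] is the projection of [y] on the range. *)
Lemma mp_inverse_exists A : closed_range_op A ->
  exists X, is_mp_inverse dot A X.
Proof.
move=> cA; have [C C0 hC] := closed_range_bounded_below cA.
move: cA => [bA cR]; have [lA _] := bA.
have sR := subspace_range lA; have mR := closed_metric_closed cR.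
have sN := subspace_nullspace lA; have mN := nullspace_metric_closed bA.
have [bP hP] := orth_projP dot_norm sR mR.
have [bQ hQ] := orth_projP dot_norm sN mN.
set P := orth_proj dot (range A) in bP hP.
set Q := orth_proj dot (nullspace A) in bQ hQ.
have sperp := linear_subspace_perp dot sN.
have /choice[X hX] y : exists x, perp (nullspace A) x /\ A x = P y.
  have [[x _ xy] _] := hP y; exists (x - Q x); split; first exact: (hQ x).2.
  by rewrite (linear_opB lA) (hQ x).1 subr0.
have inj x x' : perp (nullspace A) x -> perp (nullspace A) x' ->
    A x = A x' -> x = x'.
  move=> hx hx' e; apply/eqP; rewrite -subr_eq0; apply/eqP/rnorm_eq0.
  apply/eqP; rewrite eq_le rnorm_ge0 andbT.
  apply: le_trans (hC _ (perpB hx hx')) _.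
  by rewrite (linear_opB lA) e subrr rnorm0 mulr0.
have lX : linear X.
  move=> c x y; apply: inj; first exact: (hX _).1.
    by apply sperp.2; [exact: (hX x).1|exact: (hX y).1].
  by rewrite lA !(hX _).2 bP.1.
have bX : bounded_op X.
  apply: (@bounded_op_of_le _ _ _ C) => // y.
  apply: le_trans (hC _ (hX y).1) _; rewrite (hX y).2 ler_wpM2l//.
  exact: orth_proj_le.
have AX y : A (X y) = P y := (hX y).2.
have PA x : P (A x) = A x by apply: orth_proj_id => //; exists x.
have XA x : X (A x) = x - Q x.
  apply: inj; [exact: (hX _).1|exact: (hQ x).2|].
  by rewrite AX PA (linear_opB lA) (hQ x).1 subr0.
exists X; split => //.
- by apply/funext => x /=; rewrite AX PA.
- apply/funext => x /=; apply: inj; [exact: (hX _).1..|].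
  by rewrite AX PA.
- apply/(self_adjoint_ip dot (bounded_comp bA bX)) => x y /=.
  by rewrite !AX orth_proj_sym.
- apply/(self_adjoint_ip dot (bounded_comp bX bA)) => x y /=.
  by rewrite !XA ipBl ipBr orth_proj_sym.
Qed.

Lemma mp_inverseP A (X := mp_inverse dot A) : closed_range_op A ->
  [/\ bounded_op X, (forall x, A (X (A x)) = A x),
      (forall x, X (A (X x)) = X x),
      (forall x y, ip (A (X x)) y = ip x (A (X y))) &
      (forall x y, ip (X (A x)) y = ip x (X (A y)))].
Proof.
move=> cA; have [bA _] := cA.
have := @xgetPex _ 0 [set X | is_mp_inverse dot A X] (mp_inverse_exists cA).
rewrite -/(mp_inverse dot A) => -[bX AXA XAX sAX sXA]; split => //.
- by move=> x; exact: (congr1 (fun F => F x) AXA).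
- by move=> x; exact: (congr1 (fun F => F x) XAX).
- exact/(self_adjoint_ip dot (bounded_comp bA bX)).
- exact/(self_adjoint_ip dot (bounded_comp bX bA)).
Qed.

Lemma mp_inverse_perp A y :
  closed_range_op A -> perp (nullspace A) (mp_inverse dot A y).
Proof.
move=> cA v Av; have [bX _ XAX _ sXA] := mp_inverseP cA.
by rewrite -XAX sXA Av (linear_op0 bX.1) ip0r.
Qed.

Lemma proj_nullspace A x : closed_range_op A ->
  orth_proj dot (nullspace A) x = x - mp_inverse dot A (A x).
Proof.
move=> cA; have [bA _] := cA; have [bX AXA _ _ _] := mp_inverseP cA.
apply: (orth_proj_eq dot_norm).
- exact: subspace_nullspace bA.1.
- exact: nullspace_metric_closed.
- by rewrite /nullspace/= (linear_opB bA.1) AXA subrr.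
- by rewrite subKr; exact: mp_inverse_perp.
Qed.

(** The values of the Moore-Penrose inverse [X] are orthogonal to the nullspace,
   and [A X] is a projection. *)
Lemma opnorm_mp_inverse_le A (C : R) : closed_range_op A -> 0 <= C ->
  (forall x, perp (nullspace A) x -> rnorm x <= C * rnorm (A x)) ->
  opnorm (mp_inverse dot A) <= C.
Proof.
move=> cA C0 hC; have [bX AXA XAX sAX _] := mp_inverseP cA.
apply: opnorm_le => // y; apply: le_trans (hC _ (mp_inverse_perp _ cA)) _.
rewrite ler_wpM2l//.
by apply: (@rnorm_projection _ _ _ dot_norm (A \o mp_inverse dot A)) => //= x.
Qed.

End MoorePenrose.

(** * Square roots and the polar decomposition *)

Section PolarDecomposition.
Local Open Scope complex_scope.
Context {R : realType} {H : completeNormedModType R[i]}.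
Context (dot : {dot H for (@Num.conj R[i])}).
Hypothesis dot_norm : inner_product_norm dot.
Implicit Types (x y z u v w : H) (A B C X P : H -> H) (V W : set H).
Local Notation ip := (ip dot).
Local Notation adjoint := (adjoint dot).
Local Notation perp := (perp dot).

(** The iteration converging to [1 - T], where [T] is the square root of
   [1 - X]: its fixed points [Z] satisfy [(1 - Z) ^ 2 = 1 - X]. *)
Fixpoint sqrt_iter X (n : nat) : H -> H :=
  if n is m.+1 then
    fun x => 2^-1%:C *: (sqrt_iter X m (sqrt_iter X m x) + X x)
  else fun=> 0.

(** The same iteration for numbers, at [X = 1]; it dominates the increments of
   [sqrt_iter X] for every contraction [X]. *)
Fixpoint sqrt_rate (n : nat) : R :=
  if n is m.+1 then (sqrt_rate m ^+ 2 + 1) / 2 else 0.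

Lemma sqrt_rate_bounds n : 0 <= sqrt_rate n /\ sqrt_rate n <= 1.
Proof.
elim: n => [|n [z0 z1]] /=; first by split.
have zz : sqrt_rate n ^+ 2 <= 1 by rewrite expr2 mulr_ile1.
by split; [rewrite divr_ge0// addr_ge0// sqr_ge0|lra].
Qed.

Lemma sqrt_rateS n :
  sqrt_rate n.+1 = sqrt_rate n + (1 - sqrt_rate n) ^+ 2 / 2.
Proof. by rewrite /=; field. Qed.

Lemma sqrt_rate_cvg (e : R) : 0 < e -> exists n, 1 - sqrt_rate n < e.
Proof.
move=> e0; apply: contrapT => h.
have {}h n : e <= 1 - sqrt_rate n.
  by rewrite leNgt; apply/negP => hn; apply: h; exists n.
have grow n : n%:R * (e ^+ 2 / 2) <= sqrt_rate n.
  elim: n => [|n IH]; first by rewrite mul0r.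
  rewrite sqrt_rateS -natr1 mulrDl mul1r lerD// ler_pM2r//.
  by rewrite ler_pXn2r ?nnegrE ?(ltW e0)// (le_trans (ltW e0)).
have f0 : 0 < e ^+ 2 / 2 by rewrite divr_gt0// exprn_gt0.
have [_ z1] := sqrt_rate_bounds (Num.truncn (e ^+ 2 / 2)^-1).+1.
have := le_trans (grow _) z1; rewrite -ler_pdivlMr// div1r leNgt.
by rewrite truncnS_gt.
Qed.

Lemma sqrt_rate_small (r K : R) :
  0 <= K -> (forall n, r <= (1 - sqrt_rate n) * K) -> r <= 0.
Proof.
move=> K0 h; apply/ler_addgt0Pr => e e0; rewrite add0r.
have K1 : 0 < K + 1 by rewrite ltr_wpDl.
have [n hn] := sqrt_rate_cvg (divr_gt0 e0 K1).
apply: le_trans (h n) _; move: hn; rewrite ltr_pdivlMr// => /ltW.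
apply: le_trans; have [_ z1] := sqrt_rate_bounds n.
by rewrite ler_wpM2l ?subr_ge0// lerDl.
Qed.

Lemma rnorm_sqrt_rate_small x (K : R) :
  0 <= K -> (forall n, rnorm x <= (1 - sqrt_rate n) * K) -> x = 0.
Proof.
move=> K0 /(sqrt_rate_small K0) h; apply: rnorm_eq0.
by apply/eqP; rewrite eq_le h rnorm_ge0.
Qed.

Section SquareRoot.
Variable X : H -> H.
Hypothesis lX : linear X.
Hypothesis X_le : forall x, rnorm (X x) <= rnorm x.
Hypothesis X_sym : forall x y, ip (X x) y = ip x (X y).
Let Z := sqrt_iter X.
Let z := sqrt_rate.

Let half (x : H) : rnorm (2^-1%:C *: x) = rnorm x / 2.
Proof. by rewrite rnormZr ger0_norm ?invr_ge0// mulrC. Qed.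

Let half2 (x : H) : 2^-1%:C *: (x + x) = x.
Proof.
rewrite scalerDr -scalerDl -rmorphD/=.
by have -> : 2^-1 + 2^-1 = 1 :> R; [field|rewrite scale1r].
Qed.

Lemma sqrt_iter_linear n : linear (Z n).
Proof.
elim: n => [|n IH] c x y; first by rewrite /Z/= scaler0 addr0.
rewrite /Z/= -/(Z n) !IH lX scalerA mulrC -scalerA -scalerDr.
by congr (_ *: _); rewrite scalerDr addrACA.
Qed.

Lemma sqrt_iter_sym n x y : ip (Z n x) y = ip x (Z n y).
Proof.
elim: n x y => [|n IH] x y; first by rewrite /Z/= ip0l ip0r.
by rewrite /Z/= -/(Z n) ipZl ipZr ipDl ipDr !IH X_sym.
Qed.

Lemma sqrt_iter_le n x : rnorm (Z n x) <= z n * rnorm x.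
Proof.
elim: n x => [|n IH] x; first by rewrite /Z/= rnorm0 mul0r.
have [z0 _] := sqrt_rate_bounds n.
rewrite /Z/= -/(Z n) half mulrAC ler_pM2r// mulrDl mul1r.
apply: le_trans (rnormD _ _) _; apply: lerD => //.
apply: le_trans (IH _) _; rewrite expr2 -mulrA ler_wpM2l//.
Qed.

(** As [Z_m ^ 2 - Z_n ^ 2 = Z_m (Z_m - Z_n) + (Z_m - Z_n) Z_n], the increments
   obey the recursion of those of [sqrt_rate]. *)
Lemma sqrt_iter_dist n k x :
  rnorm (Z (n + k)%N x - Z n x) <= (z (n + k)%N - z n) * rnorm x.
Proof.
elim: n x => [|n IH] x.
  by rewrite {2}/Z {2}/z /= !subr0; exact: sqrt_iter_le.
have [zn0 _] := sqrt_rate_bounds n; have [zm0 _] := sqrt_rate_bounds (n + k).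
rewrite addSn; set m := (n + k)%N in IH zm0 *.
have -> : Z m.+1 x - Z n.+1 x =
    2^-1%:C *: (Z m (Z m x - Z n x) + (Z m (Z n x) - Z n (Z n x))).
  rewrite (linear_opB (sqrt_iter_linear m)) addrA subrK.
  by rewrite /Z/= -/(Z m) -/(Z n) -scalerBr opprD addrACA subrr addr0.
have -> : z m.+1 - z n.+1 = (z m * (z m - z n) + (z m - z n) * z n) / 2.
  by rewrite /z/=; field.
rewrite half mulrAC ler_pM2r// mulrDl; apply: le_trans (rnormD _ _) _.
apply: lerD.
  by apply: le_trans (sqrt_iter_le _ _) _; rewrite -mulrA ler_wpM2l.
apply: le_trans (IH _) _; rewrite -mulrA ler_wpM2l ?sqrt_iter_le//.
rewrite subr_ge0 /m; elim: (k) => [|j IHj]; first by rewrite addn0.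
apply: le_trans IHj _; rewrite addnS /z sqrt_rateS lerDl.
by rewrite divr_ge0// sqr_ge0.
Qed.

Lemma sqrt_iter_cvg x :
  exists y, forall n, rnorm (y - Z n x) <= (1 - z n) * rnorm x.
Proof.
have [|y yx] := @cauchy_metric_cvg _ _ (fun n => Z n x).
  move=> e e0; have x1 : 0 < rnorm x + 1 by rewrite ltr_wpDl.
  have [|N hN] := @sqrt_rate_cvg (e / (rnorm x + 1) / 2).
    by rewrite !divr_gt0.
  have near m : (N <= m)%N -> rnorm (Z m x - Z N x) < e / 2.
    move=> Nm; have := sqrt_iter_dist N (m - N)%N x; rewrite subnKC// => h.
    have [_ zm1] := sqrt_rate_bounds m.
    apply: le_lt_trans h _; rewrite mulrAC ltr_pdivlMr// in hN.
    apply: le_lt_trans hN; have : z m - z N <= 1 - z N by rewrite lerD2r.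
    move=> h; apply: le_trans (ler_wpM2r _ h) _ => //.
    rewrite ler_wpM2l ?lerDl// subr_ge0.
    by have [] := sqrt_rate_bounds N.
  exists N => m n Nm Nn; apply: le_lt_trans (rnorm_triangle _ (Z N x) _) _.
  by rewrite [ltRHS]splitr ltrD ?near// rnormBC near.
exists y => n; apply/ler_addgt0Pr => e e0; have [N hN] := yx _ e0.
apply: le_trans (rnorm_triangle _ (Z (n + N)%N x) _) _.
rewrite addrC lerD//; last by rewrite rnormBC ltW// hN// leq_addl.
apply: le_trans (sqrt_iter_dist _ _ _) _; rewrite ler_wpM2r// lerD2r.
by have [] := sqrt_rate_bounds (n + N).
Qed.

Lemma square_root_1B : exists T, [/\ bounded_op T,
  (forall x y, ip (T x) y = ip x (T y)) & forall x, T (T x) = x - X x].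
Proof.
have /choice[Y hY] := sqrt_iter_cvg.
have zn1 n : 0 <= 1 - z n by rewrite subr_ge0; have [] := sqrt_rate_bounds n.
have lY : linear Y.
  move=> c x y; apply/eqP; rewrite -subr_eq0; apply/eqP.
  apply: (@rnorm_sqrt_rate_small _
    (rnorm (c *: x + y) + complex.Re `|c| * rnorm x + rnorm y)).
    by rewrite !addr_ge0// mulr_ge0// Re_norm_ge0.
  move=> n; rewrite !mulrDr.
  have -> : Y (c *: x + y) - (c *: Y x + Y y) =
      (Y (c *: x + y) - Z n (c *: x + y)) - c *: (Y x - Z n x) - (Y y - Z n y).
    rewrite (sqrt_iter_linear n) scalerBr.
    by apply: (ip_ext dot_norm) => t; rewrite !(ipBl, ipDl); ring.
  apply: le_trans (rnormB _ _) (lerD _ (hY _ _)).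
  apply: le_trans (rnormB _ _) (lerD (hY _ _) _).
  by rewrite rnormZ mulrCA ler_wpM2l ?Re_norm_ge0.
have sY x y : ip (Y x) y = ip x (Y y).
  apply/eqP; rewrite -subr_eq0 -normr_le0; apply/(@sqrt_rate_small _
    (rnorm x * rnorm y + rnorm x * rnorm y)).
    by rewrite addr_ge0// mulr_ge0.
  move=> n; have -> : ip (Y x) y - ip x (Y y) =
      ip (Y x - Z n x) y - ip x (Y y - Z n y).
    by rewrite ipBl ipBr sqrt_iter_sym opprB addrA subrK.
  rewrite mulrDr; apply: le_trans (ler_normB _ _) _; apply: lerD.
    apply: le_trans (cauchy_schwarz_norm dot_norm _ _) _.
    by rewrite mulrA ler_wpM2r.
  apply: le_trans (cauchy_schwarz_norm dot_norm _ _) _.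
  by rewrite mulrCA ler_wpM2l.
have fixY x : Y x + Y x - (Y (Y x) + X x) = 0.
  apply: (@rnorm_sqrt_rate_small _ (3 * rnorm x + rnorm (Y x))).
    by rewrite addr_ge0// mulr_ge0.
  move=> n; have [z0 z1] := sqrt_rate_bounds n.
  have -> : Y x + Y x - (Y (Y x) + X x) = (Y x - Z n.+1 x) + (Y x - Z n.+1 x)
      - (Y (Y x) - Z n (Y x)) - Z n (Y x - Z n x).
    have := half2 (Z n.+1 x).
    have -> : X x = Z n.+1 x + Z n.+1 x - Z n (Z n x).
      by rewrite {1 2}/Z/= -/(Z n) -scalerDr half2 addrAC subrr add0r.
    rewrite (linear_opB (sqrt_iter_linear n)) => _.
    by apply: (ip_ext dot_norm) => t; rewrite !(ipBl, ipDl); ring.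
  have h1 : rnorm (Y x - Z n.+1 x) <= (1 - z n) * rnorm x.
    apply: le_trans (hY _ _) _; rewrite ler_wpM2r// lerD2l lerN2 /z sqrt_rateS.
    by rewrite lerDl divr_ge0// sqr_ge0.
  have h2 : rnorm (Z n (Y x - Z n x)) <= (1 - z n) * rnorm x.
    apply: le_trans (sqrt_iter_le _ _) _; apply: le_trans (hY x n).
    by rewrite ler_piMl.
  apply: le_trans (rnormB _ _) _; apply: le_trans (lerD (rnormB _ _) h2) _.
  apply: le_trans (lerD (lerD (rnormD _ _) (hY _ n)) (lexx _)) _.
  rewrite mulrDr -/(z n); move: h1; set a := _ * rnorm x.
  by rewrite [_ * (3 * _)]mulrCA -/a; lra.
have Y_le x : rnorm (Y x) <= 1 * rnorm x.
  have := hY x 0%N; rewrite /Z /z/= !subr0; exact.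
have bY := bounded_op_of_le lY Y_le.
exists (id - Y); split; first exact: bounded_sub bounded_id bY.
  by move=> x y; rewrite !fctE ipBl ipBr sY.
move=> x; rewrite !fctE (linear_opB lY).
have -> : X x = Y x + Y x - Y (Y x).
  by apply/esym/eqP; rewrite -subr_eq0 -addrA -opprD fixY.
by apply: (ip_ext dot_norm) => t; rewrite !(ipBl, ipDl); ring.
Qed.

End SquareRoot.

(** The square root of [adjoint E \o E]; rescaling [E] to norm at most 1 makes
   [id - adjoint E \o E] a contraction. *)
Lemma modulus_exists E : bounded_op E -> exists T, [/\ bounded_op T,
  (forall x y, ip (T x) y = ip x (T y)) &
  forall x, T (T x) = adjoint E (E x)].
Proof.
move=> bE; have bF := adjoint_bounded dot_norm bE.
have E0 := opnorm_ge0 bE; set a := opnorm E + 1.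
have a0 : 0 < a by rewrite /a ltr_wpDl.
pose X x := x - (a ^- 2)%:C *: adjoint E (E x).
have lX : linear X.
  move=> c x y; rewrite /X bE.1 bF.1 scalerDr opprD addrACA scalerBr.
  by congr (_ - _ + _); rewrite !scalerA mulrC.
have X_sym x y : ip (X x) y = ip x (X y).
  rewrite ipBl ipBr ipZl ipZr (adjointPV dot_norm)//.
  by rewrite (adjointP dot_norm).
have X_le x : rnorm (X x) <= rnorm x.
  rewrite -(@ler_pXn2r _ 2)// ?nnegrE// /X (rnormB_sqr dot_norm) ipZr rnormZr.
  rewrite -(adjointP dot_norm)// (ip_norm dot_norm) exprMn.
  rewrite ger0_norm ?invr_ge0 ?exprn_ge0 ?(ltW a0)//.
  have h : rnorm (adjoint E (E x)) ^+ 2 <= a ^+ 2 * rnorm (E x) ^+ 2.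
    rewrite -exprMn ler_pXn2r ?nnegrE ?mulr_ge0 ?(ltW a0)//.
    apply: le_trans (opnormP _ bF) _; rewrite ler_wpM2r//.
    by apply: le_trans (opnorm_adjoint dot_norm bE) _; rewrite lerDl.
  have b0 : 0 < a ^- 2 by rewrite invr_gt0 exprn_gt0.
  have {h} : a ^- 2 * (a ^- 2 * rnorm (adjoint E (E x)) ^+ 2) <=
      a ^- 2 * rnorm (E x) ^+ 2.
    by rewrite ler_pM2l// ler_pdivrMl// exprn_gt0.
  have := mulr_ge0 (ltW b0) (sqr_ge0 (rnorm (E x))).
  rewrite [(a ^- 2) ^+ 2]expr2 -mulrA.
  move: (_ * rnorm (E x) ^+ 2) (_ * (_ * rnorm (adjoint _ _) ^+ 2)).
  by move=> p q; lra.
have [T [bT sT hT]] := square_root_1B lX X_le X_sym.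
have TZ c x : T (c *: x) = c *: T x by exact: (linear_opZ bT.1).
exists (fun x => a%:C *: T x); split.
- apply: (@bounded_op_of_le _ _ _ (a * opnorm T)).
    by move=> c x y; rewrite bT.1 scalerDr !scalerA mulrC.
  move=> x; rewrite rnormZr gtr0_norm// -mulrA ler_pM2l//.
  exact: opnormP.
- by move=> x y; rewrite ipZl ipZr sT.
- move=> x; rewrite TZ hT /X subKr !scalerA -!rmorphM/=.
  have -> : a * a * a ^- 2 = 1 by rewrite -expr2 divff// expf_neq0// gt_eqF.
  by rewrite scale1r.
Qed.

(** A bounded operator vanishing on a subspace vanishes on its closure, so two
   operators agree once they agree on the two summands of a dense subspace. *)
Lemma eq_bounded_op V A B : linear_subspace V -> bounded_op A -> bounded_op B ->
  (forall x, V x -> A x = B x) -> (forall x, perp V x -> A x = B x) -> A = B.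
Proof.
move=> sV bA bB eV ep; apply/funext => y.
have bD := bounded_sub bA bB.
have sN := subspace_nullspace bD.1; have cN := nullspace_metric_closed bD.
have NV v : V v -> nullspace (A - B) v.
  by move=> Vv; rewrite /nullspace/= !fctE eV// subrr.
have [p Np hp] := projection_exists dot_norm y (real_subspaceW sN) cN.
have eq_N x : nullspace (A - B) x -> A x = B x.
  by move=> /eqP; rewrite !fctE subr_eq0 => /eqP.
rewrite -[y](subrK p) (linear_opD bA.1) (linear_opD bB.1) (eq_N p)// ep//.
by move=> v /NV; exact: hp.
Qed.

(** The relation of being simultaneously approximable by a value of [E] and the
   corresponding value of [T]: the closure of the map [E u |-> A u]. *)
Definition closure_map E A x y :=
  forall e : R, 0 < e -> exists u, rnorm (x - E u) < e /\ rnorm (y - A u) < e.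

Lemma closure_map_linear E A c x y x' y' : linear E -> linear A ->
  closure_map E A x y -> closure_map E A x' y' ->
  closure_map E A (c *: x + x') (c *: y + y').
Proof.
move=> lE lA h h' e e0; pose a := complex.Re `|c| + 1.
have a0 : 0 < a by rewrite ltr_wpDl// Re_norm_ge0.
have [u [xu yu]] := h _ (divr_gt0 e0 a0).
have [u' [xu' yu']] := h' _ (divr_gt0 e0 a0).
have main (v v' w w' : H) : rnorm (v - w) < e / a -> rnorm (v' - w') < e / a ->
    rnorm (c *: v + v' - (c *: w + w')) < e.
  move=> hv hv'; rewrite opprD addrACA -scalerBr.
  apply: le_lt_trans (rnormD _ _) _; rewrite rnormZ.
  have -> : e = complex.Re `|c| * (e / a) + e / a 
    by rewrite -[X in _ + X]mul1r -mulrDl -/a mulrC divfK// gt_eqF.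
  rewrite ler_ltD// ler_wpM2l ?Re_norm_ge0//.
  exact: ltW.
by exists (c *: u + u'); rewrite lE lA !main.
Qed.

Lemma closure_map_le E A x y : (forall u, rnorm (A u) = rnorm (E u)) ->
  closure_map E A x y -> rnorm y <= rnorm x.
Proof.
move=> EA h; apply/ler_addgt0Pr => e e0.
have [|u [xu yu]] := h (e / 2); first by rewrite divr_gt0.
have h1 : rnorm y <= rnorm (y - A u) + rnorm (A u).
  by rewrite -{1}[y](subrK (A u)) rnormD.
have h2 : rnorm (E u) <= rnorm (x - E u) + rnorm x.
  by rewrite rnormBC -{1}[E u](subrK x) rnormD.
rewrite EA in h1; lra.
Qed.

Lemma closure_map_exists E A x : linear E -> linear A ->
  (forall u, rnorm (A u) = rnorm (E u)) ->
  (forall e : R, 0 < e -> exists u, rnorm (x - E u) < e) ->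
  exists y, closure_map E A x y.
Proof.
move=> lE lA EA hx.
have /choice[u hu] (k : nat) : exists u, rnorm (x - E u) < k.+1%:R^-1.
  by apply: hx; rewrite invr_gt0.
have small (e : R) : 0 < e -> exists N, forall n, (N <= n)%N ->
    rnorm (x - E (u n)) < e.
  by move=> /invS_small[N hN]; exists N => n /hN; exact: lt_trans.
have [|y uy] := @cauchy_metric_cvg _ _ (fun n => A (u n)).
  move=> e e0; have [|N hN] := small (e / 2); first by rewrite divr_gt0.
  exists N => m n Nm Nn; rewrite -(linear_opB lA) EA (linear_opB lE).
  apply: le_lt_trans (rnorm_triangle _ x _) _.
  by rewrite [ltRHS]splitr ltrD ?hN// rnormBC hN.
exists y => e e0; have [N1 h1] := small _ e0; have [N2 h2] := uy _ e0.
exists (u (maxn N1 N2)); rewrite h1 ?leq_maxl//; split => //.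
by rewrite rnormBC h2// leq_maxr.
Qed.

(** [E x |-> T x] extends by continuity to the closure of the range of [E], and
   by 0 to its orthogonal complement. *)
Lemma partial_isometry_exists E T : bounded_op E -> bounded_op T ->
  (forall x, rnorm (T x) = rnorm (E x)) ->
  exists V : H -> H, [/\ bounded_op V, (forall y, rnorm (V y) <= rnorm y),
    (forall x, V (E x) = T x) & forall y, perp (range E) y -> V y = 0].
Proof.
move=> bE bT ET; have [lE _] := bE; have [lT _] := bT.
pose G := closure_map E T; pose cl := [set x | exists y, G x y].
have uniq x y y' : G x y -> G x y' -> y = y'.
  move=> h h'; apply/eqP; rewrite -subr_eq0; apply/eqP/rnorm_eq0.
  apply/eqP; rewrite eq_le rnorm_ge0 andbT -(@rnorm0 _ H).
  apply: (@closure_map_le E T) => //.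
  have := closure_map_linear (-1) lE lT h' h.
  by rewrite !scaleN1r addNr [- y' + y]addrC.
have GE x : G (E x) (T x) by move=> e e0; exists x; rewrite !subrr !rnorm0.
have scl : linear_subspace cl.
  split.
    by exists 0; have := GE 0; rewrite (linear_op0 lE) (linear_op0 lT).
  move=> c x x' [y h] [y' h']; exists (c *: y + y').
  exact: closure_map_linear.
have ccl : metric_closed cl.
  move=> x h; apply: closure_map_exists => // e e0.
  have [|v [y hy] xv] := h (e / 2); first by rewrite divr_gt0.
  have [|u [vu _]] := hy (e / 2); first by rewrite divr_gt0.
  exists u; apply: le_lt_trans (rnorm_triangle _ v _) _.
  by rewrite [ltRHS]splitr ltrD.
have [bP hP] := orth_projP dot_norm scl ccl.
set P := orth_proj dot cl in bP hP.
have /choice[V hV] y : exists z, G (P y) z := (hP y).1.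
have Vle y : rnorm (V y) <= rnorm y.
  apply: le_trans (closure_map_le ET (hV y)) _.
  exact: orth_proj_le.
have lV : linear V.
  move=> c x y; apply: uniq (hV _) _; rewrite bP.1.
  exact: closure_map_linear (hV x) (hV y).
have bV : bounded_op V.
  by apply: (@bounded_op_of_le _ _ _ 1) => // y; rewrite mul1r.
exists V; split => //.
  move=> x; apply: uniq (hV _) _; rewrite /P orth_proj_id//.
  by exists (T x).
move=> y hy; apply: uniq (hV _) _.
have -> : P y = 0.
  apply: (orth_proj_eq dot_norm scl ccl); first exact: scl.1.
  rewrite subr0 => x [z Gxz]; apply/eqP; rewrite -normr_le0.
  apply/ler_addgt0Pr => e e0; rewrite add0r.
  have y1 : 0 < rnorm y + 1 by rewrite ltr_wpDl.
  have [u [xu _]] := Gxz _ (divr_gt0 e0 y1).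
  rewrite -[x](subrK (E u)) ipDr (hy (E u)) ?addr0; last by exists u.
  apply: le_trans (cauchy_schwarz_norm dot_norm _ _) _.
  rewrite ltr_pdivlMr// in xu; apply: le_trans (ltW xu).
  by rewrite mulrC ler_wpM2l// lerDl.
by have := GE 0; rewrite (linear_op0 lE) (linear_op0 lT).
Qed.

(** In the polar decomposition [E = V^* T], one has [adjoint E = T V] and
   [T = V E]. *)
Lemma adjoint_factorization E : bounded_op E -> exists V : H -> H,
  [/\ bounded_op V, opnorm V <= 1 & adjoint E = V \o E \o V].
Proof.
move=> bE; have [T [bT sT hT]] := modulus_exists bE.
have ET x : rnorm (T x) = rnorm (E x).
  apply/eqP; rewrite -(@eqrXn2 _ 2)// -!(ip_norm dot_norm).
  by rewrite sT hT -(adjointP dot_norm).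
have [V [bV Vle VE V0]] := partial_isometry_exists bE bT ET.
exists V; split => //; first by apply: opnorm_le => // x; rewrite mul1r.
have bF := adjoint_bounded dot_norm bE.
have -> : V \o E = T by apply/funext => x /=; rewrite VE.
apply: (eq_bounded_op (subspace_range bE.1)) => //.
- exact: bounded_comp.
- by move=> _ [x _ <-] /=; rewrite VE hT.
- move=> y hy /=; rewrite V0// (linear_op0 bT.1).
  apply: (ip_ext dot_norm) => z; rewrite (adjointPV dot_norm)// ip0l hy//.
Qed.

End PolarDecomposition.

(** * Symmetrically-normed ideals and the Moore-Penrose inverse *)

Section SymmetricallyNormedIdeal.
Local Open Scope complex_scope.
Context {R : realType} {H : completeNormedModType R[i]}.
Context (dot : {dot H for (@Num.conj R[i])}).
Hypothesis dot_norm : inner_product_norm dot.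
Implicit Types (x y z u v w : H) (A B C X P : H -> H) (V W : set H).
Local Notation ip := (ip dot).
Local Notation adjoint := (adjoint dot).
Local Notation perp := (perp dot).

Section Ideal.
Variable S : symnormed_ideal H.

Lemma ideal_bounded A : ideal_set S A -> bounded_op A.
Proof. by move=> /ideal_compact[]. Qed.

Lemma ideal_sum A B : ideal_set S A -> ideal_set S B -> ideal_set S (A + B).
Proof.
move=> hA hB; have := ideal_linear 1 hA hB.
by rewrite (_ : 1 *: A = A)//; apply/funext => x; exact: scale1r.
Qed.

Lemma ideal_opp A : ideal_set S A -> ideal_set S (- A).
Proof.
move=> hA; have := ideal_linear (-1) hA (ideal0 S).
by rewrite addr0 scaleN1r.
Qed.

Lemma ideal_normN A : ideal_set S A -> ideal_norm S (- A) = ideal_norm S A.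
Proof.
move=> hA; rewrite -scaleN1r ideal_normZ// normrN normr1.
by rewrite /= mul1r.
Qed.

Lemma ideal_sub A B : ideal_set S A -> ideal_set S B -> ideal_set S (A - B).
Proof. by move=> hA hB; apply: ideal_sum => //; exact: ideal_opp. Qed.

Lemma ideal_normB A B : ideal_set S A -> ideal_set S B ->
  ideal_norm S (A - B) <= ideal_norm S A + ideal_norm S B.
Proof.
move=> hA hB; rewrite -(ideal_normN hB).
by apply: ideal_normD => //; exact: ideal_opp.
Qed.

Lemma ideal_norm_ge0 A : ideal_set S A -> 0 <= ideal_norm S A.
Proof.
move=> hA; have := ideal_normB hA (ideal_sub hA hA).
have := ideal_normB hA hA; rewrite subrr subr0 => h1 h2.
have : ideal_norm S (0 : H -> H) = 0.
  rewrite -(_ : (0 : R[i]) *: (0 : H -> H) = 0); last first.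
    by apply/funext => x; exact: scale0r.
  by rewrite ideal_normZ ?normr0 /= ?mul0r//; exact: ideal0.
by move=> h0; rewrite h0 in h1; lra.
Qed.

Lemma ideal_comp A B C : bounded_op A -> ideal_set S B -> bounded_op C ->
  ideal_set S (A \o B \o C).
Proof. by move=> bA hB bC; apply: ideal_mulr => //; exact: ideal_mull. Qed.

Lemma ideal_norm_comp_le A B C (a c : R) : bounded_op A -> ideal_set S B ->
  bounded_op C -> opnorm A <= a -> opnorm C <= c ->
  ideal_norm S (A \o B \o C) <= a * c * ideal_norm S B.
Proof.
move=> bA hB bC ha hc; apply: le_trans (ideal_normM bA hB bC) _.
rewrite mulrAC ler_wpM2r ?ideal_norm_ge0//.
by apply: ler_pM => //; exact: opnorm_ge0.
Qed.

Lemma ideal_adjoint E : ideal_set S E ->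
  ideal_set S (adjoint E) /\ ideal_norm S (adjoint E) <= ideal_norm S E.
Proof.
move=> hE; have [V [bV V1 ->]] := adjoint_factorization dot_norm (ideal_bounded hE).
split; first exact: ideal_comp.
by have := ideal_norm_comp_le bV hE bV V1 V1; rewrite !mul1r.
Qed.

(** For a unit vector [u], composing [A] with the projection onto the line of
   [u] gives an operator of rank one and norm [rnorm (A u)]. *)
Lemma opnorm_le_ideal_norm A : ideal_set S A -> opnorm A <= ideal_norm S A.
Proof.
move=> hA; have bA := ideal_bounded hA; have [lA _] := bA.
apply: opnorm_le => [|x]; first exact: ideal_norm_ge0.
have [->|/eqP/rnorm_gt0 Ax0] := eqVneq (A x) 0.
  by rewrite rnorm0 mulr_ge0// ideal_norm_ge0.
have x0 : 0 < rnorm x.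
  by apply/rnorm_gt0 => x0; move: Ax0; rewrite x0 (linear_op0 lA) rnorm0 ltxx.
pose u := (rnorm x)^-1%:C *: x.
have u1 : rnorm u = 1.
  by rewrite rnormZr ger0_norm ?invr_ge0// mulVf// gt_eqF.
have dotu : dot u u = 1 by rewrite -dot_norm normE u1 expr1n.
have Au : rnorm (A u) = rnorm (A x) / rnorm x.
  by rewrite (linear_opZ lA) rnormZr ger0_norm ?invr_ge0// mulrC.
have Au0 : A u <> 0.
  move=> Au0; move: Ax0; rewrite -(divfK (lt0r_neq0 x0) (rnorm (A x))).
  by rewrite -Au Au0 rnorm0 mul0r ltxx.
rewrite -ler_pdivrMr// -Au; clearbody u.
pose K y := dot y u *: u.
have lK : linear K.
  by move=> c y z; rewrite /K linearDl linearZl_LR/= scalerDl -scalerA.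
have K_le y : rnorm (K y) <= rnorm y.
  apply: (rnorm_projection dot_norm) => [{}y z|{}y].
    rewrite /K /ip linearZl_LR linearZr_LR/= mulrC.
    by have -> : Num.conj (dot z u) = dot u z := esym (dotC dot z u).
  by rewrite /K linearZl_LR/= dotu mulr1.
have bK : bounded_op K.
  by apply: (@bounded_op_of_le _ _ _ 1) => // y; rewrite mul1r.
have K1 : opnorm K <= 1 by apply: opnorm_le => // y; rewrite mul1r.
have id1 : opnorm (id : H -> H) <= 1 by apply: opnorm_le => // y; rewrite mul1r.
have r1 : rank_one_op (id \o A \o K).
  split; first by do 2 apply: bounded_comp => //; exact: bounded_id.
  exists (fun=> A u); split.
    move=> y; split => [[z _ <-]|[w [c [-> ->]]]].
      exists 0, (fun=> dot z u); split => //.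
      by rewrite big_ord1 add0r /K/= (linear_opZ lA).
    exists (c ord0 *: u) => //.
    by rewrite big_ord1 add0r /K/= linearZl_LR/= dotu mulr1 (linear_opZ lA).
  move=> c; rewrite big_ord1 => /eqP; rewrite scaler_eq0 => /orP[/eqP c0|/eqP//] i.
  by rewrite ord1.
have := ideal_norm_comp_le bounded_id hA bK id1 K1; rewrite !mul1r.
apply: le_trans; rewrite ideal_norm_rank_one//.
apply: le_trans (le_trans (opnormP u _) _); last by rewrite u1 mulr1.
  by rewrite /= /K dotu scale1r.
by do 2 apply: bounded_comp => //; exact: bounded_id.
Qed.

(** Wedin's identity: the difference [mp_inverse A - mp_inverse B] is linear in
   [E := A - B] and its adjoint. *)
Lemma mp_inverse_sub A B (X := mp_inverse dot A) (Y := mp_inverse dot B) :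
  closed_range_op A -> closed_range_op B ->
  X - Y = ((X \o adjoint X) \o adjoint (A - B) \o (id - (B \o Y)))
        + ((id - (X \o A)) \o adjoint (A - B) \o (adjoint Y \o Y))
        - (X \o (A - B) \o Y).
Proof.
move=> cA cB; have [bX AXA XAX sAX sXA] := mp_inverseP dot_norm cA.
have [bY BYB YBY sBY sYB] := mp_inverseP dot_norm cB.
have [bA _] := cA; have [bB _] := cB.
rewrite -/X -/Y in bX AXA XAX sAX sXA bY BYB YBY sBY sYB.
have bE := bounded_sub bA bB.
apply/funext => y; rewrite !(sub_opE, add_opE) /= !sub_opE /=.
set E := A - B in bE *.
have EE x : E x = A x - B x by [].
set r := y - B (Y y); set w := adjoint Y (Y y).
have rB t : ip r (B t) = 0 by rewrite /r ipBl sBY BYB subrr.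
(* B^* kills r, so that X X^* E^* r = X (A X)^* r = X A X r *)
have -> : adjoint X (adjoint E r) = A (X r).
  apply: (ip_ext dot_norm) => t.
  by rewrite !(adjointPV dot_norm)// EE ipBr rB subr0 -sAX.
(* A (id - X A) = 0 and B^* Y^* Y = Y *)
have -> : adjoint E w - X (A (adjoint E w)) = - (Y y - X (A (Y y))).
  apply: (ip_ext dot_norm) => t; rewrite ipNl !ipBl !sXA -!ipBr.
  rewrite (adjointPV dot_norm)// EE (linear_opB bA.1) AXA subrr sub0r ipNr.
  by rewrite /w (adjointPV dot_norm)// -sYB YBY.
rewrite XAX (linear_opB bX.1) /r (linear_opB bX.1).
by apply: (ip_ext dot_norm) => t; rewrite !(ipBl, ipDl, ipNl); ring.
Qed.

Lemma ideal_mp_inverse_sub A B (c : R) :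
  closed_range_op A -> closed_range_op B -> ideal_set S (A - B) ->
  opnorm (mp_inverse dot A) <= c -> opnorm (mp_inverse dot B) <= c ->
  ideal_set S (mp_inverse dot A - mp_inverse dot B) /\
  ideal_norm S (mp_inverse dot A - mp_inverse dot B)
    <= 3 * c ^+ 2 * ideal_norm S (A - B).
Proof.
move=> cA cB hE; rewrite (mp_inverse_sub cA cB).
have [bX AXA XAX sAX sXA] := mp_inverseP dot_norm cA.
have [bY BYB YBY sBY sYB] := mp_inverseP dot_norm cB.
have [bA _] := cA; have [bB _] := cB.
set X := mp_inverse dot A in bX AXA XAX sAX sXA *.
set Y := mp_inverse dot B in bY BYB YBY sBY sYB *.
set E := A - B in hE *.
have [hF FE] := ideal_adjoint hE; set F := adjoint E in hF FE *.
have bXa := adjoint_bounded dot_norm bX; have bYa := adjoint_bounded dot_norm bY.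
move=> Xc Yc; have c0 : 0 <= c := le_trans (opnorm_ge0 bX) Xc.
have bXX := bounded_comp bX bXa; have bYY := bounded_comp bYa bY.
have bp := bounded_sub bounded_id (bounded_comp bB bY).
have bq := bounded_sub bounded_id (bounded_comp bX bA).
have comp_le P Q : bounded_op P -> bounded_op Q -> opnorm P <= c ->
    opnorm Q <= c -> opnorm (P \o Q) <= c ^+ 2.
  move=> bP bQ Pc Qc; apply: opnorm_le => [|x]; first by rewrite sqr_ge0.
  apply: le_trans (opnorm_comp bP bQ x) _; rewrite ler_wpM2r//.
  by apply: ler_pM => //; exact: opnorm_ge0.
have XXc := comp_le _ _ bX bXa Xc (le_trans (opnorm_adjoint dot_norm bX) Xc).
have YYc := comp_le _ _ bYa bY (le_trans (opnorm_adjoint dot_norm bY) Yc) Yc.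
have p1 : opnorm (id - (B \o Y)) <= 1.
  apply: opnorm_le => // x; rewrite mul1r.
  apply: (@rnorm_projection _ _ _ dot_norm (id - (B \o Y)))
    => [{}x y|{}x]; rewrite !sub_opE /=.
    by rewrite ipBl ipBr /= sBY.
  by rewrite (linear_opB bY.1) (linear_opB bB.1) BYB subrr subr0.
have q1 : opnorm (id - (X \o A)) <= 1.
  apply: opnorm_le => // x; rewrite mul1r.
  apply: (@rnorm_projection _ _ _ dot_norm (id - (X \o A)))
    => [{}x y|{}x]; rewrite !sub_opE /=.
    by rewrite ipBl ipBr /= sXA.
  by rewrite (linear_opB bA.1) AXA subrr (linear_op0 bX.1) subr0.
have h1 := ideal_comp bXX hF bp; have h2 := ideal_comp bq hF bYY.
have h3 := ideal_comp bX hE bY.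
split; first by apply: ideal_sub => //; exact: ideal_sum.
apply: le_trans (ideal_normB (ideal_sum h1 h2) h3) _.
have := ideal_normD h1 h2.
have := ideal_norm_comp_le bXX hF bp XXc p1.
have := ideal_norm_comp_le bq hF bYY q1 YYc.
have := ideal_norm_comp_le bX hE bY Xc Yc.
have : c ^+ 2 * ideal_norm S F <= c ^+ 2 * ideal_norm S E.
  by rewrite ler_wpM2l// sqr_ge0.
rewrite mul1r mulr1 -expr2; set n1 := ideal_norm S (_ + _); lra.
Qed.

(** The nullspace projections [id - X A] inherit the convergence of [A] and of
   its Moore-Penrose inverse [X]. *)
Lemma ideal_proj_nullspace_sub A B :
  closed_range_op A -> closed_range_op B -> ideal_set S (A - B) ->
  ideal_set S (mp_inverse dot A - mp_inverse dot B) ->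
  let P := orth_proj dot (nullspace A) - orth_proj dot (nullspace B) in
  ideal_set S P /\
  ideal_norm S P
    <= opnorm B * ideal_norm S (mp_inverse dot A - mp_inverse dot B)
     + opnorm (mp_inverse dot A) * ideal_norm S (A - B).
Proof.
move=> cA cB hE hD P.
have [bX _ _ _ _] := mp_inverseP dot_norm cA.
have [bA _] := cA; have [bB _] := cB.
set X := mp_inverse dot A in bX hD *; set Y := mp_inverse dot B in hD *.
have PE : P = - (id \o (X - Y) \o B) - (X \o (A - B) \o id).
  apply/funext => x; rewrite !(sub_opE, opp_opE) /P sub_opE.
  rewrite !(proj_nullspace dot_norm)// -/X -/Y /=.
  rewrite !sub_opE (linear_opB bX.1).
  by apply: (ip_ext dot_norm) => t; rewrite !(ipBl, ipDl, ipNl); ring.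
have id1 : opnorm (id : H -> H) <= 1 by apply: opnorm_le => // y; rewrite mul1r.
have h1 := ideal_comp bounded_id hD bB; have h2 := ideal_comp bX hE bounded_id.
rewrite PE; split; first by apply: ideal_sub => //; exact: ideal_opp.
apply: le_trans (ideal_normB (ideal_opp h1) h2) _; rewrite ideal_normN//.
have := ideal_norm_comp_le bounded_id hD bB id1 (lexx _).
have := ideal_norm_comp_le bX hE bounded_id (lexx _) id1.
by rewrite mul1r mulr1 => *; exact: lerD.
Qed.

End Ideal.

End SymmetricallyNormedIdeal.

(** * Nullspaces of nearby operators *)

Section NearbyNullspaces.
Local Open Scope complex_scope.
Context {R : realType} {H : completeNormedModType R[i]}.
Context (dot : {dot H for (@Num.conj R[i])}).
Hypothesis dot_norm : inner_product_norm dot.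
Implicit Types (x y z u v w : H) (A B C X P : H -> H) (V W : set H).
Local Notation ip := (ip dot).
Local Notation adjoint := (adjoint dot).
Local Notation perp := (perp dot).

Section NearbyOperators.
Variables (A B : H -> H) (C e : R).
Hypothesis cA : closed_range_op A.
Hypothesis cB : closed_range_op B.
Hypothesis C_ge0 : 0 <= C.
Hypothesis B_below : forall x, perp (nullspace B) x -> rnorm x <= C * rnorm (B x).
Hypothesis AB_close : forall x, rnorm ((A - B) x) <= e * rnorm x.
Hypothesis Ce_small : C * e <= 8^-1.
Let NA := nullspace A.
Let NB := nullspace B.
Let Q := orth_proj dot NB.

Let bA : bounded_op A. Proof. by case: cA. Qed.
Let bB : bounded_op B. Proof. by case: cB. Qed.
Let sNA : linear_subspace NA. Proof. exact: subspace_nullspace bA.1. Qed.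
Let sNB : linear_subspace NB. Proof. exact: subspace_nullspace bB.1. Qed.
Let mNA : metric_closed NA. Proof. exact: nullspace_metric_closed. Qed.
Let mNB : metric_closed NB. Proof. exact: nullspace_metric_closed. Qed.
Let bQ : bounded_op Q. Proof. by case: (orth_projP dot_norm sNB mNB). Qed.
Let NBQ x : NB (Q x).
Proof. by have [_ /(_ x)[]] := orth_projP dot_norm sNB mNB. Qed.
Let perpQ x : perp NB (x - Q x).
Proof. by have [_ /(_ x)[]] := orth_projP dot_norm sNB mNB. Qed.

Let B_le x : C * rnorm (B x) <= C * rnorm (A x) + 8^-1 * rnorm x.
Proof.
have h : rnorm (B x) <= rnorm (A x) + e * rnorm x.
  have -> : B x = A x - (A - B) x by rewrite sub_opE subKr.
  by apply: le_trans (rnormB _ _) _; rewrite lerD2l.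
apply: le_trans (ler_wpM2l C_ge0 h) _; rewrite mulrDr lerD2l mulrA.
by rewrite ler_wpM2r.
Qed.

Lemma nullspace_near_proj y : NA y -> rnorm (y - Q y) <= 8^-1 * rnorm y.
Proof.
move=> Ay; apply: le_trans (B_below (perpQ y)) _.
rewrite (linear_opB bB.1) [B (Q y)]NBQ subr0.
by apply: le_trans (B_le y) _; rewrite Ay rnorm0 mulr0 add0r.
Qed.

Lemma nullspace_le_proj y : NA y -> rnorm y <= 2 * rnorm (Q y).
Proof.
move=> /nullspace_near_proj; have : rnorm y <= rnorm (y - Q y) + rnorm (Q y).
  by rewrite -{1}[y](subrK (Q y)) rnormD.
by have := rnorm_ge0 y; lra.
Qed.

Lemma nullspace_proj_inj y : NA y -> Q y = 0 -> y = 0.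
Proof.
move=> /nullspace_le_proj h Qy; apply: rnorm_eq0; apply/eqP.
by rewrite eq_le rnorm_ge0 andbT; rewrite Qy rnorm0 mulr0 in h.
Qed.

(** Being bounded below on [NA], [Q] maps it onto a closed subspace of [NB];
   the vectors of [NB] orthogonal to that subspace are those orthogonal to
   [NA]. *)
Lemma nullspace_proj_onto :
  (forall x, perp NA x -> NB x -> x = 0) <-> Q @` NA = NB.
Proof.
split=> [h|QNA x hx NBx]; last first.
  have [y Ay yx] : (Q @` NA) x by rewrite QNA.
  apply: (ip_eq0 dot_norm); rewrite -{2}yx.
  by rewrite -(orth_proj_sym dot_norm)// orth_proj_id// hx.
have sW := subspace_image bQ.1 sNA.
have cW : metric_closed (Q @` NA).
  exact: bounded_below_closed bQ sNA mNA nullspace_le_proj.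
apply/seteqP; split=> [_ [y _ <-]|x NBx]; first exact: NBQ.
have [p [y Ay yp] hp] := projection_exists dot_norm x (real_subspaceW sW) cW.
exists y => //; rewrite yp; apply/esym/eqP; rewrite -subr_eq0; apply/eqP.
have NBxp : NB (x - p) by rewrite -yp; exact: subspaceB.
apply: h => // v Av.
rewrite -[x - p](orth_proj_id dot_norm sNB mNB)// (orth_proj_sym dot_norm)//.
by rewrite hp//; exists v.
Qed.

(** For [x] orthogonal to [NA], write [Q x = Q y] with [y] in [NA]; then
   [rnorm (Q x) ^+ 2 = ip x (Q y - y)] is small, so that [x] is close to the
   orthogonal complement of [NB], where [B] is bounded below. *)
Lemma bounded_below_nearby : Q @` NA = NB ->
  forall x, perp NA x -> rnorm x <= 2 * C * rnorm (A x).
Proof.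
move=> QNA x hx; have [y Ay yx] : (Q @` NA) (Q x) by rewrite QNA.
have Qx : rnorm (Q x) <= 4^-1 * rnorm x.
  apply: (rnorm_le_of_ip dot_norm); first by rewrite mulr_ge0.
  have -> : ip (Q x) (Q x) = - ip x (y - Q y).
    rewrite ipBr (hx _ Ay) sub0r opprK yx.
    by rewrite (orth_proj_sym dot_norm)// orth_proj_id.
  rewrite -ipNr; apply: le_trans (cauchy_schwarz dot_norm _ _) _.
  rewrite rnormN mulrAC [_ * rnorm x]mulrC ler_wpM2l//.
  apply: le_trans (nullspace_near_proj Ay) _.
  by have := nullspace_le_proj Ay; rewrite yx; lra.
have h1 : rnorm x <= rnorm (x - Q x) + rnorm (Q x).
  by rewrite -{1}[x](subrK (Q x)) rnormD.
have h2 := B_below (perpQ x).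
rewrite (linear_opB bB.1) [B (Q x)]NBQ subr0 in h2.
have h3 := B_le x; have := rnorm_ge0 x; lra.
Qed.

(** The kernel of [Q P] is trivial, so that the index vanishes exactly when the
   cokernel is trivial too. *)
Lemma ess_codim_eq0 (P := orth_proj dot NA) :
  fredholm_pair P Q /\ ess_codim P Q = 0 <-> Q @` NA = NB.
Proof.
have rP : range P = NA by exact: range_orth_proj.
have rQ : range Q = NB by exact: range_orth_proj.
have PNA y : NA y -> P y = y by move=> Ay; exact: orth_proj_id.
have ker : kernel_on (range P) (Q \o P) = [set 0].
  rewrite rP; apply/seteqP; split=> [y [Ay]|_ ->].
    by rewrite /nullspace/= PNA// => Qy; exact: nullspace_proj_inj.
  by split; [exact: sNA.1|rewrite /nullspace/= PNA ?(linear_op0 bQ.1)//; exact: sNA.1].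
have img : (Q \o P) @` range P = Q @` NA.
  rewrite rP; apply/seteqP; split=> _ [y Ay <-]; exists y => //=.
    by rewrite PNA.
  by rewrite PNA.
rewrite /fredholm_pair /ess_codim /fredholm_between /fredholm_index ker img rQ.
rewrite dim_mod_refl//; split=> [[[_ [_ [n hn]]]]|QNA].
  move=> /eqP; rewrite subr_eq0 eq_sym => /eqP[d0].
  have := @xgetPex _ 0%N [set n | has_dim_mod NB (Q @` NA) n].
  rewrite -/(dim_mod NB (Q @` NA)) => /(_ (ex_intro _ n hn)).
  by rewrite d0 => /has_dim_mod0.
rewrite QNA dim_mod_refl ?subrr; last exact: sNB.1.
split=> //; split=> [x _|]; first exact: NBQ.
by split; exists 0%N; exact/has_dim_mod0.
Qed.

End NearbyOperators.

End NearbyNullspaces.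

(** * Boundedness and convergence of real sequences *)

Lemma ereal_sup_ltyP (R : realType) (f : nat -> R) :
  (ereal_sup (range (fun n => (f n)%:E)) < +oo)%E <->
  exists M, forall n, f n <= M.
Proof.
split=> [h|[M hM]]; last first.
  apply: le_lt_trans (ltry M); apply: ge_ereal_sup => _ [n _ <-].
  by rewrite lee_fin.
have ub n : ((f n)%:E <= ereal_sup (range (fun n => (f n)%:E)))%E.
  by apply: ereal_sup_ubound; exists n.
case: ereal_sup h ub => [M _ ub|//|_ ub]; last by have := ub 0%N.
by exists M => n; rewrite -lee_fin.
Qed.

Lemma near_bounded (R : realType) (f : nat -> R) (M : R) :
  (\forall n \near \oo, f n <= M) -> exists M', forall n, f n <= M'.
Proof.
move=> [N _ hN]; exists (`|M| + \sum_(i < N) `|f i|) => n.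
have [Nn|nN] := leqP N n.
  apply: le_trans (hN n Nn) _; apply: le_trans (ler_norm _) _.
  by rewrite lerDl sumr_ge0.
rewrite (bigD1 (Ordinal nN))//= addrCA; apply: le_trans (ler_norm _) _.
by rewrite lerDl addr_ge0// sumr_ge0.
Qed.

Lemma squeeze_cvg0 (R : realType) (f g : nat -> R) (K : R) :
  (forall n, 0 <= f n <= K * g n) -> g @ \oo --> (0 : R) ->
  f @ \oo --> (0 : R).
Proof.
move=> fg g0; apply: (@squeeze_cvgr _ _ _ _ (fun=> 0) (fun n => K * g n)).
- exact: nearW.
- exact: cvg_cst.
- by rewrite -(mulr0 K); exact: cvgMr.
Qed.

Lemma cvg0_near_lt (R : realType) (f : nat -> R) (e : R) :
  f @ \oo --> (0 : R) -> 0 < e -> \forall n \near \oo, f n < e.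
Proof. by move=> f0 e0; exact: (cvgr_lt _ f0). Qed.

(** * The equivalence *)

Theorem theorem3p4 (R : realType) (H : completeNormedModType R[i])
  (dot : {dot H for (@Num.conj R[i])})
  (dot_norm : inner_product_norm dot)
  (H_separable : separable H)
  (H_infinite : infinite_dimensional H)
  (S : symnormed_ideal H)
  (B_ : nat -> H -> H) (B : H -> H)
  (B_cr : forall n, closed_range_op (B_ n))
  (B_lim_cr : closed_range_op B)
  (B_cvg : cvg_in_ideal S B_ B) :
  let PN := fun A : H -> H => orth_proj dot (nullspace A) in
  [<->
    (* i *) \forall n \near \oo,
      fredholm_pair (PN (B_ n)) (PN B) /\ ess_codim (PN (B_ n)) (PN B) = 0;
    (* ii *) (ereal_sup
      (range (fun n => (opnorm (mp_inverse dot (B_ n)))%:E)) < +oo)%E;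
    (* iii *) cvg_in_ideal S (fun n => mp_inverse dot (B_ n)) (mp_inverse dot B);
    (* iv *) \forall n \near \oo,
      ideal_set S (PN (B_ n) - PN B) /\ ideal_norm S (PN (B_ n) - PN B) < 1;
    (* v *) \forall n \near \oo, opnorm (PN (B_ n) - PN B) < 1;
    (* vi *) \forall n \near \oo,
      orthogonal_compl dot (nullspace (B_ n)) `&` nullspace B = [set 0]
  ].
Proof.
move=> PN; have [B_in B_to0] := B_cvg; have [bB _] := B_lim_cr.
have [C C0 hC] := closed_range_bounded_below dot_norm B_lim_cr.
(* the perturbation estimates apply once the norm of B_n - B is at most e *)
pose e := (C + 1)^-1 / 8.
have C1 : 0 < C + 1 by rewrite ltr_wpDl.
have e0 : 0 < e by rewrite divr_gt0// invr_gt0.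
have Ce : C * e <= 8^-1.
  by rewrite /e mulrA ler_piMl// ler_pdivrMr// mul1r lerDl.
have close : \forall n \near \oo,
    forall x, rnorm ((B_ n - B) x) <= e * rnorm x.
  have := cvg0_near_lt B_to0 e0; apply: filterS => n hn x.
  have bE := ideal_bounded (B_in n).
  apply: le_trans (opnormP _ bE) _; rewrite ler_wpM2r//.
  apply: le_trans (opnorm_le_ideal_norm dot_norm (B_in n)) _.
  exact: ltW.
have bY : bounded_op (mp_inverse dot B).
  by have [] := mp_inverseP dot_norm B_lim_cr.
have sN n := subspace_nullspace (B_cr n).1.1.
have mN n := nullspace_metric_closed (B_cr n).1.
have sNB := subspace_nullspace bB.1.
have mNB := nullspace_metric_closed bB.
tfae.
- move=> hi; apply/ereal_sup_ltyP.
  apply: (@near_bounded _ _ (2 * C)).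
  move: close hi; apply: filterS2 => n AB.
  move=> /(ess_codim_eq0 dot_norm (B_cr n) B_lim_cr C0 hC AB Ce) QN.
  apply: (opnorm_mp_inverse_le dot_norm (B_cr n)); first by rewrite mulr_ge0.
  exact: (bounded_below_nearby dot_norm B_lim_cr C0 hC AB Ce QN).
- move=> /ereal_sup_ltyP[M hM].
  pose c := Num.max M (opnorm (mp_inverse dot B)).
  have M_le : M <= c by rewrite le_max lexx.
  have Y_le : opnorm (mp_inverse dot B) <= c by rewrite le_max lexx orbT.
  have hD n := ideal_mp_inverse_sub dot_norm (B_cr n) B_lim_cr (B_in n)
    (le_trans (hM n) M_le) Y_le.
  split=> [n|]; first by have [] := hD n.
  apply: (@squeeze_cvg0 _ _ _ (3 * c ^+ 2) _ B_to0) => n.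
  by have [h ->] := hD n; rewrite ideal_norm_ge0.
- move=> [X_in X_to0].
  set b := opnorm B; set y := opnorm (mp_inverse dot B).
  have b0 : 0 <= b := opnorm_ge0 bB.
  have y0 : 0 <= y := opnorm_ge0 bY.
  have f1 : 0 < (b + 1)^-1 / 2 by rewrite divr_gt0// invr_gt0 ltr_wpDl.
  have f2 : 0 < (y + 1)^-1 / 2 by rewrite divr_gt0// invr_gt0 ltr_wpDl.
  have n1 := cvg0_near_lt X_to0 f1.
  have n2 := cvg0_near_lt X_to0 ltr01.
  have n3 := cvg0_near_lt B_to0 f2.
  move: n1 n2 n3; apply: filterS3 => n h1 h2 h3.
  have [hin hle] := ideal_proj_nullspace_sub dot_norm (B_cr n) B_lim_cr
    (B_in n) (X_in n).
  split=> //; apply: le_lt_trans hle _; rewrite -/b.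
  have Xy : opnorm (mp_inverse dot (B_ n)) <= y + 1.
    apply: opnorm_le => [|x]; first by rewrite addr_ge0.
    rewrite -[X in rnorm X](subrK (mp_inverse dot B x)) addrC mulrDl.
    apply: le_trans (rnormD _ _) _; apply: lerD; first exact: opnormP.
    apply: le_trans (opnormP x (ideal_bounded (X_in n))) _.
    rewrite ler_wpM2r//; apply: le_trans (ltW h2).
    exact: opnorm_le_ideal_norm.
  have E0 := ideal_norm_ge0 (B_in n); have D0 := ideal_norm_ge0 (X_in n).
  rewrite [_ / 2]mulrC ltr_pdivlMr ?ltr_wpDl// in h1.
  rewrite [_ / 2]mulrC ltr_pdivlMr ?ltr_wpDl// in h3.
  have := ler_wpM2r E0 Xy; move: h1 h3; rewrite mulrDr mulr1 [_ * b]mulrC.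
  by rewrite [_ * (y + 1)]mulrC; lra.
- apply: filterS => n [hin h]; apply: le_lt_trans h.
  exact: opnorm_le_ideal_norm.
- apply: filterS => n h; apply/seteqP; split=> [x|_ ->]; last first.
    split; last exact: sNB.1.
    by move=> v _; rewrite linear0l.
  move=> [/(orthogonal_complE dot _ (sN n)) hx NBx].
  have [bP _] := orth_projP dot_norm (sN n) (mN n).
  have [bQ _] := orth_projP dot_norm sNB mNB.
  have := opnormP x (bounded_sub bP bQ); rewrite -/(PN _) -/(PN _) => hle.
  apply: contrapT => /rnorm_gt0 x0; move: hle; apply/negP; rewrite -ltNge.
  rewrite sub_opE [PN B x]orth_proj_id//.
  have -> : PN (B_ n) x = 0.
    by apply: (orth_proj_eq dot_norm) => //; [exact: (sN n).1|rewrite subr0].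
  by rewrite sub0r rnormN -[ltRHS]mul1r ltr_pM2r.
- move: close; apply: filterS2 => n AB h.
  apply/(ess_codim_eq0 dot_norm (B_cr n) B_lim_cr C0 hC AB Ce).
  apply/(nullspace_proj_onto dot_norm (B_cr n) B_lim_cr C0 hC AB Ce).
  move=> x hx NBx; suff : [set 0] x by [].
  by rewrite -h; split => //; exact/orthogonal_complE.
Qed.
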